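(* Let $k$ be an algebraically closed field and let $A$ be a finite-dimensional $k$-algebra which is a cellular algebra or a BGG algebra. Let $\{L(\lambda)\}_{\lambda\in\pi}$ be a full set of pairwise non-isomorphic simple left $A$-modules and let $P(\lambda)$ be the projective cover of $L(\lambda)$. Then for all $\lambda,\mu\in\pi$ and all integers $s\geq 1$, $$[\operatorname{rad}_sP(\mu):L(\lambda)]=[\operatorname{rad}_sP(\lambda):L(\mu)].$$
   Context: Modules are finite-dimensional left modules, and $[M:L]$ denotes the multiplicity of the simple module $L$ as a composition factor of $M$. Radical series: $\operatorname{rad}^0M=M$, $\operatorname{rad}^1M=\operatorname{rad}M$ is the smallest submodule of $M$ with semisimple quotient, and $\operatorname{rad}^{s}M=\operatorname{rad}(\operatorname{rad}^{s-1}M)$. The $s$-th radical layer ($s\ge1$) is $\operatorname{rad}_sM=\operatorname{rad}^{s-1}M/\operatorname{rad}^sM$, so $\operatorname{rad}_1M$ is the head of $M$. Cellular algebra: an associative $k$-algebra $A$ with a finite poset $\Gamma$, a finite set $M(\gamma)$ for each $\gamma\in\Gamma$, and a $k$-basis $\{C^\gamma_{S,T}:\gamma\in\Gamma,\ S,T\in M(\gamma)\}$ such that (i) the $k$-linear map $i$ with $i(C^\gamma_{S,T})=C^\gamma_{T,S}$ is an anti-automorphism of $A$ with $i^2=\mathrm{id}$; (ii) for all $a\in A$, $\gamma\in\Gamma$ and $S,T\in M(\gamma)$, one has $aC^\gamma_{S,T}=\sum_{U\in M(\gamma)}r_a(U,S)C^\gamma_{U,T}+r'$, where $r_a(U,S)\in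 k$ does not depend on $T$ and $r'$ is a linear combination of basis elements with upper index strictly less than $\gamma$. (The set $\pi$ indexing the simple modules need not be all of $\Gamma$.) BGG algebra: suppose $\pi$ is a poset indexing the simple $A$-modules. The standard module $\Delta(\lambda)$ is the maximal factor module of $P(\lambda)$ all of whose composition factors are of the form $L(\mu)$ with $\mu\le\lambda$. The algebra $A$ is quasi-hereditary if $\operatorname{End}_A(\Delta(\lambda))\cong k$ for all $\lambda\in\pi$ and every projective module has a filtration by standard modules. A duality on $A$-mod is a contravariant, exact, additive functor $\delta$ from $A$-mod to itself such that $\delta\circ\delta$ is naturally equivalent to the identity and $\delta$ is $k$-linear on the spaces $\operatorname{Hom}_A(M,N)$. A BGG algebra is a quasi-hereditary algebra with a duality $\delta$ on $A$-mod such that $\delta(L(\lambda))\cong L(\lambda)$ for all $\lambda\in\pi$. *)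

(* Defs.v *)
From HB Require Import structures.
From mathcomp Require Import all_boot all_order all_algebra all_field.
From mathcomp Require Import zify boolp.
From Stdlib Require Relation_Definitions.

Set Implicit Arguments.
Unset Strict Implicit.
Unset Printing Implicit Defensive.

Import GRing.Theory.
Local Open Scope ring_scope.

Section Modules.

Variables (k : fieldType) (A : falgType k).

Record fdmod := FdMod {
  carrier :> vectType k;
  act : A -> 'End(carrier);
  act_linear : linear act;
  act1 : act 1 = \1%VF;
  actM : forall a b, act (a * b) = (act a \o act b)%VF }.

Definition equivariant (M N : fdmod) : {pred 'Hom(M, N)} :=
  fun f => `[< forall a v, f (act M a v) = act N a (f v) >].

Lemma equivariant_submod M N : submod_closed (@equivariant M N).
Proof.
split=> [|c f g /asboolP fE /asboolP gE]; apply/asboolP => a v.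
  by rewrite !lfunE /= linear0.
by rewrite !lfunE /= !lfunE /= fE gE linearP.
Qed.

HB.instance Definition _ (M N : fdmod) :=
  GRing.isSubmodClosed.Build k 'Hom(M, N) (@equivariant M N)
    (equivariant_submod M N).

Record hom (M N : fdmod) := MkHom {
  lfun_of_hom :> 'Hom(M, N);
  hom_equivariant : lfun_of_hom \in @equivariant M N }.

HB.instance Definition _ M N := [isSub for @lfun_of_hom M N].
HB.instance Definition _ M N := [Choice of hom M N by <:].
HB.instance Definition _ M N := [SubChoice_isSubLmodule of hom M N by <:].

Lemma homP M N (f : hom M N) a v : f (act M a v) = act N a (f v).
Proof. by have /asboolP := hom_equivariant f. Qed.

Lemma hom_id_subproof M : \1%VF \in @equivariant M M.
Proof. by apply/asboolP => a v; rewrite !id_lfunE. Qed.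

Definition hom_id M : hom M M := MkHom (hom_id_subproof M).

Lemma hom_comp_subproof M N Q (g : hom N Q) (f : hom M N) :
  (g \o f)%VF \in @equivariant M Q.
Proof. by apply/asboolP => a v; rewrite !comp_lfunE !homP. Qed.

Definition hom_comp M N Q (g : hom N Q) (f : hom M N) : hom M Q :=
  MkHom (hom_comp_subproof g f).

Definition iso (M N : fdmod) : Prop := exists f : hom M N, bijective f.

Definition stable (M : fdmod) : {pred {vspace M}} :=
  fun U => `[< forall a u, u \in U -> act M a u \in U >].

Record submod (M : fdmod) := Submod {
  space :> {vspace M};
  space_stable : space \in @stable M }.

HB.instance Definition _ M := [isSub for @space M].
HB.instance Definition _ M := [Choice of submod M by <:].

Lemma submodP M (U : submod M) a u : u \in (U : {vspace M}) -> act M a u \in (U : {vspace M}).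
Proof. by have /asboolP := space_stable U; apply. Qed.

Lemma fullv_stable M : fullv \in @stable M.
Proof. by apply/asboolP => a u _; rewrite memvf. Qed.

Definition fullmod M : submod M := Submod (fullv_stable M).

Section SubQuotient.

Variables (M : fdmod) (U : submod M).

Definition sub_act (a : A) : 'End(subvs_of U) :=
  (linfun (vsproj U) \o act M a \o linfun vsval)%VF.

Lemma sub_actE a u : vsval (sub_act a u) = act M a (vsval u).
Proof.
by rewrite !comp_lfunE !lfunE /= vsprojK //; apply/submodP/subvsP.
Qed.

Lemma sub_act_linear : linear sub_act.
Proof.
move=> c a b; apply/lfunP => u; apply/val_inj.
by rewrite /= sub_actE act_linear !add_lfunE !scale_lfunE linearP /= !sub_actE.
Qed.

Lemma sub_act1 : sub_act 1 = \1%VF.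
Proof.
by apply/lfunP => u; apply/val_inj; rewrite /= sub_actE act1 !id_lfunE.
Qed.

Lemma sub_actM a b : sub_act (a * b) = (sub_act a \o sub_act b)%VF.
Proof.
by apply/lfunP => u; apply/val_inj; rewrite /= comp_lfunE !sub_actE actM comp_lfunE.
Qed.

Definition sub_mod : fdmod := FdMod sub_act_linear sub_act1 sub_actM.

(* The quotient M / U is carried by the chosen linear complement U^C, through
   the projection of M onto U^C along U. *)
Definition quot_pi : 'Hom(M, subvs_of (U^C)%VS) :=
  (linfun (vsproj (U^C)%VS) \o daddv_pi (U^C)%VS U)%VF.

Definition quot_act (a : A) : 'End(subvs_of (U^C)%VS) :=
  (quot_pi \o act M a \o linfun vsval)%VF.

Lemma compl_cap : ((U^C) :&: U = 0)%VS.
Proof. by rewrite capvC capv_compl. Qed.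

Lemma quot_piE v : vsval (quot_pi v) = daddv_pi (U^C)%VS U v.
Proof. by rewrite comp_lfunE lfunE /= vsprojK ?memv_pi. Qed.

Lemma quot_pi_sub v : v - vsval (quot_pi v) \in (U : {vspace M}).
Proof.
have vUU : v \in (U^C + U)%VS by rewrite addvC addv_complf memvf.
rewrite quot_piE -{1}(daddv_pi_add compl_cap vUU) addrC addKr.
exact: memv_pi.
Qed.

Lemma quot_piK : cancel vsval quot_pi.
Proof.
by move=> w; apply/val_inj; rewrite /= quot_piE daddv_pi_id ?compl_cap ?subvsP.
Qed.

Lemma limg_quot_pi : limg quot_pi = fullv.
Proof.
apply/vspaceP => w; rewrite memvf; apply/memv_imgP.
by exists (vsval w); rewrite ?memvf ?quot_piK.
Qed.

Lemma lker_quot_pi : lker quot_pi = U.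
Proof.
apply/vspaceP => v; rewrite memv_ker; apply/eqP/idP => [v0|vU].
  by have := quot_pi_sub v; rewrite v0 subr0.
apply/val_inj/eqP; rewrite linear0 -memv0 -compl_cap memv_cap subvsP /=.
by have := rpredB vU (quot_pi_sub v); rewrite opprB addrCA subrr addr0.
Qed.

Lemma quot_actE a v : quot_act a (quot_pi v) = quot_pi (act M a v).
Proof.
have -> : quot_act a (quot_pi v) = quot_pi (act M a (vsval (quot_pi v))).
  rewrite /quot_act (comp_lfunE (quot_pi \o _)%VF) (comp_lfunE quot_pi). by rewrite (lfunE (vsval (U := (U^C)%VS))).
apply/eqP; rewrite -subr_eq0 -!linearB -memv_ker lker_quot_pi.
by apply: submodP; rewrite -opprB rpredN quot_pi_sub.
Qed.

Lemma quot_act_linear : linear quot_act.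
Proof.
move=> c a b; apply/lfunP => u; rewrite -(quot_piK u) !add_lfunE !scale_lfunE.
by rewrite !quot_actE act_linear add_lfunE scale_lfunE linearP.
Qed.

Lemma quot_act1 : quot_act 1 = \1%VF.
Proof.
by apply/lfunP => u; rewrite -(quot_piK u) quot_actE act1 !id_lfunE.
Qed.

Lemma quot_actM a b : quot_act (a * b) = (quot_act a \o quot_act b)%VF.
Proof.
by apply/lfunP => u; rewrite -(quot_piK u) comp_lfunE !quot_actE actM comp_lfunE.
Qed.

Definition quot_mod : fdmod := FdMod quot_act_linear quot_act1 quot_actM.

End SubQuotient.

Definition simple (M : fdmod) : Prop :=
  (fullv : {vspace M}) <> 0%VS /\
  forall U : submod M, (U : {vspace M}) = 0%VS \/ (U : {vspace M}) = fullv.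

Definition semisimple (M : fdmod) : Prop :=
  exists (n : nat) (S : 'I_n -> submod M),
    [/\ forall i, simple (sub_mod (S i)),
        directv (\sum_(i < n) (S i : {vspace M}))
      & (\sum_(i < n) (S i : {vspace M}))%VS = fullv].

Definition is_rad (M : fdmod) (R : submod M) : Prop :=
  semisimple (quot_mod R) /\
  forall U : submod M, semisimple (quot_mod U) -> (R <= U)%VS.

Section Existence.

Implicit Types M : fdmod.

Lemma preim_stable M (U : submod M) (W : submod (quot_mod U)) :
  (quot_pi U @^-1: W)%VS \in @stable M.
Proof.
apply/asboolP => a u; rewrite -!memv_preim => uW; rewrite -quot_actE.
exact: (submodP (U := W)).
Qed.

Lemma simple_quot M (U : submod M) : (U : {vspace M}) != fullv ->
  (forall W : submod M, (U <= W)%VS -> (W : {vspace M}) = U \/ (W : {vspace M}) = fullv) ->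
  simple (quot_mod U).
Proof.
move=> Unf maxU; split=> [Q0|W].
  move/eqP: Unf; apply; apply/vspaceP => v; rewrite memvf -lker_quot_pi memv_ker.
  by rewrite -memv0 -Q0 memvf.
have WE : (W : {vspace quot_mod U}) = (quot_pi U @: (quot_pi U @^-1: W))%VS.
  apply/esym; apply: lpreimK; rewrite limg_quot_pi; exact: subvf.
have UW : (U <= Submod (preim_stable W))%VS.
  apply/subvP => u; rewrite /= -memv_preim -{1}lker_quot_pi memv_ker => /eqP ->.
  exact: mem0v.
case: (maxU _ UW) => /= E; [left|right]; rewrite WE E ?limg_quot_pi //.
by apply/eqP; rewrite -lkerE lker_quot_pi.
Qed.

Lemma img_stable M (U X : submod M) :
  (quot_pi U @: X)%VS \in @stable (quot_mod U).
Proof.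
apply/asboolP => a _ /memv_imgP[u uX ->].
by rewrite [act _ _ _]quot_actE memv_img ?submodP.
Qed.

Lemma capm_stable M (U V : submod M) : (U :&: V)%VS \in @stable M.
Proof.
by apply/asboolP => a u; rewrite !memv_cap => /andP[uU uV]; rewrite !submodP.
Qed.

Lemma addm_stable M (U V : submod M) : (U + V)%VS \in @stable M.
Proof.
apply/asboolP => a _ /memv_addP[u uU [v vV ->]].
by rewrite linearD memv_add ?submodP.
Qed.

Lemma preim_quotK M (U : submod M) (X : {vspace M}) : (U <= X)%VS ->
  (quot_pi U @^-1: (quot_pi U @: X))%VS = X.
Proof.
move=> UX; apply/vspaceP => v; rewrite -memv_preim; apply/idP/idP; last exact: memv_img.
case/memv_imgP => x xX /eqP; rewrite -subr_eq0 -linearB -memv_ker lker_quot_pi.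
by move=> /(subvP UX) vx; rewrite -(subrK x v) rpredD.
Qed.

Lemma img_quotK M (U : submod M) (W : {vspace quot_mod U}) :
  (quot_pi U @: (quot_pi U @^-1: W))%VS = W.
Proof. by apply: lpreimK; rewrite limg_quot_pi subvf. Qed.

Lemma simple_subP M (T : submod M) : simple (sub_mod T) <->
  (T : {vspace M}) <> 0%VS /\ forall V : submod M, (V <= T)%VS ->
    (V : {vspace M}) = 0%VS \/ (V : {vspace M}) = T.
Proof.
pose inc : 'Hom(sub_mod T, M) := linfun vsval.
have incE x : inc x = vsval x by rewrite lfunE.
have inc0 : lker inc == 0%VS.
  by apply/lker0P => x y; rewrite !incE => /val_inj.
have incT : limg inc = T.
  apply/vspaceP => v; apply/memv_imgP/idP => [[u _ ->]|vT]; rewrite ?incE ?subvsP //.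
  by exists (vsproj T v); rewrite ?memvf // incE vsprojK.
have T0 : (T : {vspace M}) = 0%VS <-> (fullv : {vspace sub_mod T}) = 0%VS.
  split=> [T0|T0]; last by rewrite -incT T0 limg0.
  by apply/eqP; rewrite -(eq_limg_ker0 _ _ inc0) incT T0 limg0.
split=> [[nT0 sT]|[nT0 sT]]; split=> [|V].
- by rewrite T0.
- move=> VT.
  have st : (inc @^-1: V)%VS \in @stable (sub_mod T).
    apply/asboolP => a u; rewrite -!memv_preim !incE => uV.
    by rewrite [vsval _]sub_actE submodP.
  have VE : (inc @: (inc @^-1: V))%VS = V by rewrite lpreimK ?incT.
  by case: (sT (Submod st)) => /= E; [left|right]; rewrite -VE E ?limg0 ?incT.
- by rewrite -T0.
have st : (inc @: V)%VS \in @stable M.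
  apply/asboolP => a _ /memv_imgP[u uV ->].
  by rewrite incE -sub_actE -incE memv_img // (submodP (U := V)).
have VT : (inc @: V <= T)%VS by rewrite -incT limgS ?subvf.
case: (sT (Submod st) VT) => /= E; [left|right]; apply/eqP.
  by rewrite -(eq_limg_ker0 _ _ inc0) E limg0.
by rewrite -(eq_limg_ker0 _ _ inc0) E incT.
Qed.

(* U <= V and V / U is simple. *)
Definition sfac M (U V : submod M) :=
  [/\ (U <= V)%VS, (U : {vspace M}) <> V & forall X : submod M, (U <= X)%VS -> (X <= V)%VS ->
    (X : {vspace M}) = U \/ (X : {vspace M}) = V].

Lemma sub_preim M (U : submod M) (W : {vspace quot_mod U}) :
  (U <= quot_pi U @^-1: W)%VS.
Proof.
apply/subvP => u; rewrite /= -memv_preim -{1}lker_quot_pi memv_ker => /eqP ->.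
exact: mem0v.
Qed.

Lemma simple_sfac M (U : submod M) (T : submod (quot_mod U)) :
  simple (sub_mod T) <-> sfac U (Submod (preim_stable T)).
Proof.
rewrite simple_subP; split=> [[nT0 sT]|[_ nT0 sT]].
  split=> [|E|X UX XT] /=; first exact: sub_preim.
    apply: nT0; rewrite -(img_quotK T); move: E => /= <-; apply/eqP.
    by rewrite -lkerE lker_quot_pi.
  case: (sT (Submod (img_stable U X))) => /= [|E|E].
  - by rewrite -(img_quotK T) limgS.
  - by rewrite -(preim_quotK UX) E lpreim0 lker_quot_pi; left.
  - by rewrite -(preim_quotK UX) E; right.
split=> [T0|V VT].
  by apply: nT0; rewrite /= T0 lpreim0 lker_quot_pi.
case: (sT (Submod (preim_stable V)) (sub_preim _)) => /=; first exact: lpreimS.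
  by move=> E; left; rewrite -(img_quotK V) E; apply/eqP; rewrite -lkerE lker_quot_pi.
by move=> E; right; rewrite -(img_quotK V) E img_quotK.
Qed.

Lemma sfac_dia M (U V X Y : submod M) :
  (X : {vspace M}) = (U :&: V)%VS -> (Y : {vspace M}) = (U + V)%VS ->
  sfac U Y <-> sfac X V.
Proof.
move=> XE YE; split=> [[UY nUY sUY]|[XV nXV sXV]].
- split=> [|E|Z XZ ZV]; first by rewrite XE capvSr.
    apply: nUY; rewrite YE; apply/esym/addv_idPl; apply/capv_idPr; by rewrite -XE.
  have ZE : (Z : {vspace M}) = ((U + Z) :&: V)%VS.
    rewrite addvC -vspace_modl // -XE; apply/esym/addv_idPl; exact: XZ.
  have := sUY (Submod (addm_stable U Z)); case => /=; rewrite ?addvSl ?YE ?addvS //.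
    by move=> E; left; rewrite ZE E XE.
  by move=> E; right; rewrite ZE E; apply/capv_idPr; rewrite addvSr.
split=> [|E|Z UZ ZY]; first by rewrite YE addvSl.
  apply: nXV; rewrite XE; apply/capv_idPr/addv_idPl; by rewrite -YE.
have ZE : (Z : {vspace M}) = (U + (V :&: Z))%VS.
  by rewrite vspace_modl // -YE; apply/esym/capv_idPr.
have := sXV (Submod (capm_stable V Z)); case => /=.
- by rewrite XE capvC capvS.
- exact: capvSl.
- by move=> E; left; rewrite ZE E XE; apply/addv_idPl; rewrite capvSl.
by move=> E; right; rewrite ZE E YE.
Qed.

Lemma dim_quot_img M (U : submod M) (X : {vspace M}) : (U <= X)%VS ->
  (\dim (quot_pi U @: X) + \dim U = \dim X)%N.
Proof.
by move=> UX; rewrite -(limg_ker_dim (quot_pi U) X) lker_quot_pi (capv_idPr UX) addnC.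
Qed.

Lemma semisimple_cap M (U K : submod M) : semisimple (quot_mod U) ->
  sfac K (fullmod M) -> ~~ (U <= K)%VS ->
  semisimple (quot_mod (Submod (capm_stable U K))).
Proof.
move=> [n [S [simS dS SE]]] simK nUK; set W := Submod _.
have WU : (W <= U)%VS by rewrite capvSl.
have UKE : (U + K)%VS = fullv.
  case: simK => _ _ /(_ (Submod (addm_stable U K))) /=; rewrite addvSr subvf.
  case=> // /addv_idPr UK; by rewrite UK in nUK.
pose V j := Submod (capm_stable K (Submod (preim_stable (S j)))).
have VE j : (U + V j)%VS = (quot_pi U @^-1: S j)%VS.
  by rewrite vspace_modl ?sub_preim // UKE capfv.
have simV j : sfac W (V j).
  apply/(@sfac_dia _ U (V j) W (Submod (preim_stable (S j)))); rewrite ?VE //=.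
    by rewrite capvA; apply/esym/capv_idPl/(subv_trans WU)/sub_preim.
  exact/simple_sfac.
have simU : sfac W U.
  by apply/(@sfac_dia _ K U W (fullmod M)); rewrite //= 1?capvC 1?addvC.
pose F i : submod M := if unlift ord_max i is Some j then V j else U.
have simF i : sfac W (F i) by rewrite /F; case: unliftP.
have WF i : (W <= F i)%VS by case: (simF i).
pose T i := Submod (img_stable W (F i)).
have FE : (\sum_(i < n.+1) F i = \sum_(j < n) V j + U)%VS.
  rewrite big_ord_recr /= {2}/F unlift_none; congr (_ + _)%VS; apply: eq_bigr => j _.
  rewrite /F; suff -> : widen_ord (leqnSn n) j = lift ord_max j by rewrite liftK.
  by apply/val_inj; rewrite /= /bump leqNgt ltn_ord.
have Ffull : (\sum_(i < n.+1) F i)%VS = fullv.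
  have UF : (U <= \sum_(i < n.+1) F i)%VS by rewrite FE addvSr.
  rewrite -(preim_quotK UF) FE limgD limg_sum.
  suff -> : (\sum_(j < n) quot_pi U @: V j = fullv)%VS.
    apply/eqP; rewrite eqEsubv subvf; apply/subvP => v _.
    by rewrite -memv_preim addvC addvf memvf.
  rewrite -SE; apply: eq_bigr => j _; rewrite -[RHS](img_quotK (U := U)) -VE limgD.
  by rewrite [X in (X + _)%VS](_ : _ = 0%VS) ?add0v //; apply/eqP; rewrite -lkerE lker_quot_pi.
have Tfull : (\sum_(i < n.+1) T i)%VS = fullv.
  by rewrite -limg_sum Ffull limg_quot_pi.
exists n.+1, T; split=> // [i|].
  apply/simple_sfac; suff -> : Submod (preim_stable (T i)) = F i by [].
  by apply/val_inj/preim_quotK.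
have dimTV j : \dim (quot_pi W @: V j) = \dim (S j).
  have := dimv_sum_cap U (V j); rewrite VE.
  have -> : (U :&: V j)%VS = W.
    rewrite /= capvA; apply/capv_idPl/(subv_trans WU)/sub_preim.
  have := dim_quot_img (sub_preim (S j)); rewrite img_quotK => <-.
  have := dim_quot_img (X := V j) (U := W); case: (simV j) => -> _ _ /(_ isT) <-.
  by move/eqP; rewrite addnA eqn_add2r (addnC (\dim U)) eqn_add2r => /eqP ->.
rewrite directvE /= Tfull big_ord_recr /= /F unlift_none.
under eq_bigr => j _.
  rewrite (_ : widen_ord (leqnSn n) j = lift ord_max j) ?liftK; last first.
    by apply/val_inj; rewrite /= /bump leqNgt ltn_ord.
  rewrite dimTV; over.
move: dS; rewrite directvE /= SE => /eqP <-.

have aux a b c t u w : (a + w = c -> b + u = c -> t + w = u -> b + t = a)%N by lia.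
have := aux _ _ _ _ _ _ (dim_quot_img (subvf W)) (dim_quot_img (subvf U)) (dim_quot_img WU).
by rewrite !limg_quot_pi => ->.
Qed.

Lemma semisimple_le M (U R : submod M) : semisimple (quot_mod U) ->
  (forall K : submod M, sfac K (fullmod M) -> (U <= K)%VS -> (R <= K)%VS) -> (R <= U)%VS.
Proof.
move=> [n [S [simS dS SE]]] RK; apply/subvP => r rR.
rewrite -lker_quot_pi memv_ker; set x := quot_pi U r.
have /memv_sumP[s sS xE] : x \in (\sum_(i < n) (S i : {vspace quot_mod U}))%VS.
  by rewrite SE memvf.
rewrite xE big1 // => j _.
pose T : {vspace quot_mod U} := (\sum_(i < n | i != j) S i)%VS.
have Tst : T \in @stable (quot_mod U).
  apply/asboolP => a _ /memv_sumP[t tT ->]; rewrite linear_sum; apply: memv_sumr => i ij.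
  exact/submodP/tT.
pose K := Submod (preim_stable (Submod Tst)).
pose Sj := Submod (preim_stable (S j)).
have TSj : (T :&: S j = 0)%VS by rewrite capvC; apply: (directv_sumP dS).
have simK : sfac K (fullmod M).
  apply/(@sfac_dia _ K Sj U (fullmod M)) => /=.
  - apply/vspaceP => v; rewrite memv_cap -!memv_preim -memv_cap TSj.
    by rewrite memv0 -memv_ker lker_quot_pi.
  - rewrite -(preim_quotK (subvf U)).
    have UKS : (U <= K + Sj)%VS by apply: subv_trans (addvSl _ _); apply: sub_preim.
    rewrite -(preim_quotK UKS) limgD !img_quotK limg_quot_pi -SE.
    by rewrite (bigD1 j) //= addvC.
  exact/simple_sfac.
have /(_ r rR) := subvP (RK K simK (sub_preim _)).
rewrite -memv_preim -/x xE (bigD1 j) //= => xT.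
apply/eqP; rewrite -memv0 -TSj memv_cap sS // andbT.
have sT : \sum_(i < n | i != j) s i \in T by apply: memv_sumr => i _; apply: sS.
by have := rpredB xT sT; rewrite addrK.
Qed.

Lemma exists_rad M : exists R : submod M, is_rad R.
Proof.
pose p d := `[< exists2 U : submod M, semisimple (quot_mod U) & \dim U = d >].
have ex_p : exists d, p d.
  exists (\dim {:M}); apply/asboolP; exists (fullmod M) => //.
  exists 0%N, (fun _ => fullmod _); split=> [[]//||].
    by rewrite directvE /= !big_ord0 dimv0.
  rewrite big_ord0 -limg_quot_pi; apply/esym/eqP; by rewrite -lkerE lker_quot_pi.
case: (ex_minnP ex_p) => d /asboolP[R ssR <-{d}] minR; exists R; split=> // U ssU.
apply: (semisimple_le ssU) => K simK UK; apply: contraT => nRK.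
have le_R : (\dim R <= \dim (R :&: K))%N.
  apply: minR; apply/asboolP; exists (Submod (capm_stable R K)) => //.
  exact: semisimple_cap.
case/negP: nRK; apply/capv_idPl/eqP; by rewrite eqEdim capvSl.
Qed.
End Existence.

Definition rad (M : fdmod) : submod M := sval (cid (exists_rad M)).

Lemma radP (M : fdmod) : is_rad (rad M).
Proof. exact: svalP (cid (exists_rad M)). Qed.

Fixpoint rad_pow (s : nat) (M : fdmod) : fdmod :=
  if s is s'.+1 then sub_mod (rad (rad_pow s' M)) else M.

(* The s-th radical layer, numbered from s = 1. *)
Definition rad_layer (s : nat) (M : fdmod) : fdmod :=
  quot_mod (rad (rad_pow s.-1 M)).

(* filtration M s: there is a chain of submodules M = M_0 >= M_1 >= ... >= M_n = 0
   whose successive factors M_i / M_(i+1) are the entries of s. *)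
Inductive filtration : fdmod -> seq fdmod -> Prop :=
| FiltNil (M : fdmod) of (fullv : {vspace M}) = 0%VS : filtration M [::]
| FiltCons (M : fdmod) (U : submod M) (s : seq fdmod) of
    filtration (sub_mod U) s : filtration M (quot_mod U :: s).

Definition composition_series (M : fdmod) (s : seq fdmod) : Prop :=
  filtration M s /\ all (fun X => `[< simple X >]) s.

Lemma exists_comp_series M : exists s, composition_series M s.
Proof.
have [n le_n] := ubnP (\dim {:M}); elim: n M le_n => // n IHn M le_n.
have [M0|M_n0] := eqVneq (fullv : {vspace M}) 0%VS.
  by exists [::]; split=> //; apply: FiltNil.
pose p d := `[< exists2 U : submod M, (U : {vspace M}) != fullv & \dim U = d >].
have z_st : (0%VS : {vspace M}) \in @stable M.
  by apply/asboolP => a u; rewrite !memv0 => /eqP ->; rewrite linear0.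
have ex_p : exists d, p d.
  by exists (\dim (0%VS : {vspace M})); apply/asboolP; exists (Submod z_st); rewrite //= eq_sym.
have le_p d : p d -> (d <= \dim {:M})%N.
  by move=> /asboolP[U _ <-]; apply: dimvS; apply: subvf.
case: (ex_maxnP ex_p le_p) => d /asboolP[U Unf <-{d}] maxU.
have Us : simple (quot_mod U).
  apply: simple_quot => // W UW; have [->|Wnf] := eqVneq (W : {vspace M}) fullv; first by right.
  left; apply/esym/eqP; rewrite eqEdim UW maxU //; apply/asboolP; by exists W.
have [|s [fs ss]] := IHn (sub_mod U).
  rewrite /= dimvf; apply: leq_trans (_ : \dim U < \dim {:M})%N _ => //.
  by rewrite ltn_neqAle !(dimv_leqif_eq (subvf U)) Unf.
exists (quot_mod U :: s); split; first exact: FiltCons.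
by rewrite /= ss andbT; apply/asboolP.
Qed.

(* [M : L]; the composition series is chosen arbitrarily, which is harmless by
   the Jordan-Hoelder theorem. *)
Definition mult (M L : fdmod) : nat :=
  count (fun X => `[< iso X L >]) (sval (cid (exists_comp_series M))).

Definition projective (Q : fdmod) : Prop :=
  forall (M N : fdmod) (g : hom M N) (f : hom Q N),
    limg g = fullv -> exists h : hom Q M, hom_comp g h = f.

(* P is projective and has an epimorphism onto L with superfluous kernel. *)
Definition projective_cover (P L : fdmod) : Prop :=
  projective P /\
  exists f : hom P L, limg f = fullv /\
    forall U : submod P, (U + lker f)%VS = fullv -> (U : {vspace P}) = fullv.

Definition full_set_of_simples (pi : Type) (L : pi -> fdmod) : Prop :=
  [/\ forall l, simple (L l),
      forall l m, iso (L l) (L m) -> l = m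
    & forall S, simple S -> exists l, iso S (L l)].

Definition short_exact (M N Q : fdmod) (f : hom M N) (g : hom N Q) : Prop :=
  [/\ lker f = 0%VS, limg f = lker g & limg g = fullv].

(* Additivity of the functor is part of dual_linear. *)
Record duality := Duality {
  dual_obj :> fdmod -> fdmod;
  dual_map : forall M N : fdmod, hom M N -> hom (dual_obj N) (dual_obj M);
  dual_id : forall M, dual_map (hom_id M) = hom_id (dual_obj M);
  dual_comp : forall M N Q (g : hom N Q) (f : hom M N),
    dual_map (hom_comp g f) = hom_comp (dual_map f) (dual_map g);
  dual_linear : forall M N, linear (@dual_map M N);
  dual_exact : forall M N Q (f : hom M N) (g : hom N Q),
    short_exact f g -> short_exact (dual_map g) (dual_map f);
  dual_eta : forall M, hom M (dual_obj (dual_obj M));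
  dual_eta_bij : forall M, bijective (dual_eta M);
  dual_eta_natural : forall M N (f : hom M N),
    hom_comp (dual_eta N) f = hom_comp (dual_map (dual_map f)) (dual_eta M) }.

(* End_A(D) is isomorphic to k as a k-algebra. *)
Definition End_iso_k (D : fdmod) : Prop :=
  exists phi : k -> hom D D,
    [/\ bijective phi, forall c a b, phi (c * a + b) = c *: phi a + phi b,
        phi 1 = hom_id D & forall a b, phi (a * b) = hom_comp (phi a) (phi b)].

Section HighestWeight.

Variables (pi : Type) (le : pi -> pi -> Prop) (L P : pi -> fdmod).

Definition factors_below (l : pi) (M : fdmod) : Prop :=
  forall S : fdmod, simple S -> (0 < mult M S)%N ->
    exists2 m, le m l & iso S (L m).

(* The largest factor module of P l of this kind is the one with the smallest
   kernel. *)
Definition is_standard (l : pi) (D : fdmod) : Prop :=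
  exists K : submod (P l),
    [/\ iso D (quot_mod K), factors_below l (quot_mod K)
      & forall U : submod (P l), factors_below l (quot_mod U) -> (K <= U)%VS].

Definition quasi_hereditary : Prop :=
  exists Delta : pi -> fdmod,
    [/\ forall l, is_standard l (Delta l),
        forall l, End_iso_k (Delta l)
      & forall Q : fdmod, projective Q -> exists2 s, filtration Q s &
          all (fun X => `[< exists l, iso X (Delta l) >]) s].

End HighestWeight.

Definition BGG_algebra (pi : Type) (L P : pi -> fdmod) : Prop :=
  exists le : pi -> pi -> Prop,
    [/\ Relation_Definitions.order pi le, quasi_hereditary le L P
      & exists delta : duality, forall l, iso (delta (L l)) (L l)].

(* cell_all is the cell basis, indexed by all triples (g, S, T); cell_coef a U S
   is the coefficient r_a(U, S), which must not depend on T. *)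
Record cell_datum := CellDatum {
  cell_disp : Order.disp_t;
  cell_poset : finPOrderType cell_disp;
  cell_index : cell_poset -> finType;
  cell_elt : forall g, cell_index g -> cell_index g -> A;
  cell_inv : 'End(A);
  cell_coef : A -> forall g, cell_index g -> cell_index g -> k;
  cell_all := fun x : {g : cell_poset & (cell_index g * cell_index g)%type} =>
    cell_elt (tagged x).1 (tagged x).2;
  cell_basis : basis_of fullv [seq cell_all x | x <- enum predT];
  cell_invE : forall g (S T : cell_index g),
    cell_inv (cell_elt S T) = cell_elt T S;
  cell_invM : forall a b, cell_inv (a * b) = cell_inv b * cell_inv a;
  cell_invK : forall a, cell_inv (cell_inv a) = a;
  cell_mul : forall a g (S T : cell_index g),
    exists2 r, r \in <<[seq cell_all x | x <- enum predT & (tag x < g)%O]>>%VS &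
      a * cell_elt S T = \sum_(U : cell_index g) cell_coef a U S *: cell_elt U T + r }.

Definition cellular : Prop := inhabited cell_datum.

End Modules.

(* Main.v *)
From HB Require Import structures.
From mathcomp Require Import all_boot all_order all_algebra all_field.
From mathcomp Require Import boolp.
Require Import Defs.

(** The statement follows from the existence of a contravariant duality [d] on
    modules that fixes every simple module up to isomorphism; a BGG algebra has
    one by definition.  For such a [d] put T_s(M) = M / rad^s(M) and
      c_s(mu, lambda) = [T_s(P(mu)) : L(lambda)].
    The layer rad^s / rad^(s+1) sits in an exact sequence with T_(s+1) and T_s
    ([truncation_exact]), so its multiplicities are the differences
    c_(s+1) - c_s, and it is enough to see that each c_s is symmetric.

    Over an algebraically closed field [M : L(lambda)] is the dimension of
    Hom(P(lambda), M) ([mult_hdim]): the latter is additive on exact sequences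
    since P(lambda) is projective, and on simple modules Schur's lemma and the
    superfluity of the kernel of P(lambda) -> L(lambda) give 1 or 0
    ([hdim_cover]).  As [d] is exact and fixes the simples, M and d(M) have the
    same multiplicities ([hdim_dual]).  Moreover d(T_s(M)) is again annihilated
    by the s-th power of the radical ([loewy_dual_truncation]), so that maps from
    P(lambda) to it factor through T_s(P(lambda)).  Hence
      c_s(mu, lambda) = dim Hom(P(lambda), d(T_s P(mu)))
                      = dim Hom(T_s P(lambda), d(T_s P(mu))),
    and the last expression is symmetric because Hom(M, d(N)) and Hom(N, d(M))
    have the same dimension ([hdim_dual_le]).

    For a cellular algebra, [d] is the linear dual with the action twisted by the
    anti-involution ([twist_duality]).  That it fixes a simple module S
    ([cell_simple_self_dual]) comes from the cell form: S is a quotient of the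
    cell module of a minimal cell acting nontrivially on it, and the symmetric
    form on that cell module descends to a nonzero invariant form on S. *)

Set Implicit Arguments.
Unset Strict Implicit.
Unset Printing Implicit Defensive.

Import GRing.Theory Order.TTheory.
Local Open Scope ring_scope.

(** * Homomorphism spaces and exact sequences *)

(** Take a subspace of largest dimension inside the predicate: adding the line of
    any further vector of the predicate would enlarge it. *)
Lemma closed_vspace (k : fieldType) (V : vectType k) (p : {pred V}) :
  submod_closed p -> exists U : {vspace V}, U =i p.
Proof.
move=> [p0 pD].
pose q d := `[< exists2 U : {vspace V}, {subset U <= p} & \dim U = d >].
have ex_q : exists d, q d.
  exists 0%N; apply/asboolP; exists 0%VS; last exact: dimv0.
  by move=> v; rewrite memv0 => /eqP->.
have le_q d : q d -> (d <= \dim {:V})%N.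
  by move=> /asboolP[U _ <-]; apply/dimvS/subvf.
case: (ex_maxnP ex_q le_q) => d /asboolP[U Up <-{d}] maxU.
exists U => v; apply/idP/idP => [/Up //|pv].
have /maxU : q (\dim (U + <[v]>)%VS).
  apply/asboolP; exists (U + <[v]>)%VS => // _ /memv_addP[u uU [w /vlineP[c ->] ->]].
  by rewrite addrC; apply: pD => //; apply: Up.
rewrite (geq_leqif (dimv_leqif_sup (addvSl U <[v]>))) subv_add => /andP[_ /subvP]; apply.
exact: memv_line.
Qed.

Section HomSpaces.

Variables (k : fieldType) (A : falgType k).
Implicit Types M N Q X Y : fdmod A.

Lemma hom_eqP M N (f g : hom M N) : (forall v, f v = g v) -> f = g.
Proof. by move=> fg; apply/val_inj/lfunP. Qed.

Lemma hom_addE M N (f g : hom M N) v : (f + g) v = f v + g v.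
Proof. exact: add_lfunE. Qed.

Lemma hom_scaleE M N c (f : hom M N) v : (c *: f) v = c *: f v.
Proof. exact: scale_lfunE. Qed.

Lemma hom0E M N v : (0 : hom M N) v = 0.
Proof. exact: zero_lfunE. Qed.

Lemma hom_compE M N Q (g : hom N Q) (f : hom M N) v : hom_comp g f v = g (f v).
Proof. exact: comp_lfunE. Qed.

Lemma hom_idE M v : hom_id M v = v.
Proof. exact: id_lfunE. Qed.

Definition hom_vspace M N : {vspace 'Hom(M, N)} :=
  sval (cid (closed_vspace (@equivariant_submod k A M N))).

Lemma mem_hom_vspace M N : hom_vspace M N =i @equivariant k A M N.
Proof. exact: svalP (cid (closed_vspace (@equivariant_submod k A M N))). Qed.

Lemma hom_vspaceP M N (f : hom M N) : (f : 'Hom(M, N)) \in hom_vspace M N.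
Proof. by rewrite mem_hom_vspace hom_equivariant. Qed.

Lemma hom_vect_axiom M N : Vector.axiom (\dim (hom_vspace M N)) (hom M N).
Proof.
have [r rL rB] : Vector.axiom (\dim (hom_vspace M N)) (subvs_of (hom_vspace M N)).
  exact: subvs_vect_iso.
pose i (f : hom M N) := Subvs (hom_vspaceP f).
exists (fun f => r (i f)).
  move=> c f g; rewrite -rL; congr r; exact: val_inj.
apply: bij_comp rB _.
have iP (w : subvs_of (hom_vspace M N)) : vsval w \in @equivariant k A M N.
  by rewrite -mem_hom_vspace subvsP.
by exists (fun w => MkHom (iP w)) => f; apply/val_inj.
Qed.

(** Homomorphism spaces get a dimension, so that [hdim] can be compared through
    linear maps between them. *)
HB.instance Definition _ M N :=
  Lmodule_hasFinDim.Build k (hom M N) (@hom_vect_axiom M N).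

Definition hdim M N : nat := \dim {:hom M N}.

Lemma hdim_le_inj M N X Y (phi : hom M N -> hom X Y) :
  linear phi -> (forall f, phi f = 0 -> f = 0) -> (hdim M N <= hdim X Y)%N.
Proof.
move=> phiL phi0.
pose phiM := GRing.isLinear.Build k (hom M N) (hom X Y) *:%R phi phiL.
pose phiT : {linear hom M N -> hom X Y} := HB.pack phi phiM.
have K0 : lker (linfun phiT) = 0%VS.
  apply/eqP; rewrite -subv0; apply/subvP => f; rewrite memv_ker lfunE => /eqP f0.
  by rewrite memv0; apply/eqP/phi0.
rewrite /hdim -(limg_dim_eq (f := linfun phiT) (U := fullv)) ?K0 ?capv0 //.
exact/dimvS/subvf.
Qed.

Lemma hdim_le_surj M N X Y (phi : hom X Y -> hom M N) :
  linear phi -> (forall f, exists g, phi g = f) -> (hdim M N <= hdim X Y)%N.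
Proof.
move=> phiL phiS.
pose phiM := GRing.isLinear.Build k (hom X Y) (hom M N) *:%R phi phiL.
pose phiT : {linear hom X Y -> hom M N} := HB.pack phi phiM.
rewrite /hdim; suff <- : limg (linfun phiT) = fullv.
  by rewrite -(limg_ker_dim (linfun phiT) fullv) leq_addl.
apply/vspaceP => f; rewrite memvf; have [g <-] := phiS f.
by apply/memv_imgP; exists g; rewrite ?memvf // lfunE.
Qed.

Lemma hom_comp_linearr M N Q (g : hom N Q) : linear (@hom_comp k A M N Q g).
Proof.
move=> c f f'; apply: hom_eqP => v.
by rewrite hom_compE hom_addE hom_scaleE linearP hom_addE hom_scaleE !hom_compE.
Qed.

Lemma hom_comp_linearl M N Q (f : hom M N) : linear ((@hom_comp k A M N Q)^~ f).
Proof.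
move=> c g g'; apply: hom_eqP => v.
by rewrite hom_compE !hom_addE !hom_scaleE !hom_compE.
Qed.

Lemma hom_comp0 M N Q (f : hom M N) : hom_comp (0 : hom N Q) f = 0.
Proof. by apply: hom_eqP => v; rewrite hom_compE !hom0E. Qed.

Lemma hom_lift M N X (f : hom M N) (h : hom X N) :
  lker f = 0%VS -> (limg h <= limg f)%VS -> exists g : hom X M, hom_comp f g = h.
Proof.
move=> f0 hf.
have fK x : f ((f^-1)%VF (h x)) = h x.
  by rewrite limg_lfunVK // (subvP hf) // memv_img ?memvf.
have fI : injective f by apply/lker0P; rewrite f0.
have eq : (f^-1 \o h)%VF \in @equivariant k A X M.
  apply/asboolP => a x; apply: fI.
  by rewrite !comp_lfunE fK !homP fK.
by exists (MkHom eq); apply: hom_eqP => x; rewrite hom_compE /= comp_lfunE fK.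
Qed.

Lemma hom_desc M N X (g : hom M N) (h : hom M X) :
  limg g = fullv -> (lker g <= lker h)%VS -> exists f : hom N X, hom_comp f g = h.
Proof.
move=> gS gh.
have gK y : g ((g^-1)%VF y) = y by rewrite limg_lfunVK // gS memvf.
have hK x : h ((g^-1)%VF (g x)) = h x.
  apply/eqP; rewrite -subr_eq0 -linearB -memv_ker (subvP gh) // memv_ker.
  by rewrite linearB /= gK subrr.
have eq : (h \o g^-1)%VF \in @equivariant k A N X.
  apply/asboolP => a y; rewrite -[y]gK -homP !comp_lfunE !hK.
  by rewrite homP.
by exists (MkHom eq); apply: hom_eqP => x; rewrite hom_compE /= comp_lfunE hK.
Qed.

Lemma hom_bij M N (f : hom M N) : lker f = 0%VS -> limg f = fullv -> bijective f.
Proof.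
move=> f0 fS; exists (f^-1)%VF => x; first by rewrite lker0_lfunK ?f0.
by rewrite limg_lfunVK ?fS ?memvf.
Qed.

Lemma hom_bij_ker M N (f : hom M N) : bijective f -> lker f = 0%VS.
Proof. by move=> /bij_inj fI; apply/eqP/lker0P. Qed.

Lemma hom_bij_img M N (f : hom M N) : bijective f -> limg f = fullv.
Proof.
case=> g fK gK; apply/vspaceP => y; rewrite memvf; apply/memv_imgP.
by exists (g y); rewrite ?memvf ?gK.
Qed.

Lemma iso_sym M N : iso M N -> iso N M.
Proof.
case=> f fB; have [|g fg] := @hom_lift _ _ _ f (hom_id N) (hom_bij_ker fB).
  by rewrite (hom_bij_img fB) subvf.
have fK y : f (g y) = y by rewrite -hom_compE fg hom_idE.
by exists g, f => // x; apply: (bij_inj fB).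
Qed.

Lemma iso_trans M N Q : iso M N -> iso N Q -> iso M Q.
Proof.
move=> [f fB] [g gB]; exists (hom_comp g f).
by apply: (eq_bij (bij_comp gB fB)) => v; rewrite hom_compE.
Qed.

Lemma hdim_iso_le X M N : iso M N -> (hdim X M <= hdim X N)%N.
Proof.
case=> f /hom_bij_ker fB; apply: hdim_le_inj (hom_comp_linearr f) _ => g fg0.
apply: hom_eqP => x; apply/eqP; rewrite hom0E -memv0 -fB memv_ker.
by rewrite -hom_compE fg0 hom0E.
Qed.

Lemma hdim_iso X M N : iso M N -> hdim X M = hdim X N.
Proof.
by move=> MN; apply/eqP; rewrite eqn_leq !hdim_iso_le //; apply: iso_sym.
Qed.

Lemma hdim_zero X M : (fullv : {vspace M}) = 0%VS -> hdim X M = 0%N.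
Proof.
move=> M0; apply/eqP; rewrite dimv_eq0 -subv0; apply/subvP => f _.
rewrite memv0; apply/eqP/hom_eqP => x; apply/eqP.
by rewrite hom0E -memv0 -M0 memvf.
Qed.

Lemma sub_incl_subproof M (U : submod M) :
  linfun vsval \in @equivariant k A (sub_mod U) M.
Proof. by apply/asboolP => a v; rewrite !(lfunE (vsval (U := U))); apply: sub_actE. Qed.

Definition sub_incl M (U : submod M) : hom (sub_mod U) M :=
  MkHom (sub_incl_subproof U).

Lemma sub_inclE M (U : submod M) v : sub_incl U v = vsval v.
Proof. by rewrite lfunE. Qed.

Lemma lker_sub_incl M (U : submod M) : lker (sub_incl U) = 0%VS.
Proof. by apply/eqP/lker0P => x y; rewrite !sub_inclE => /val_inj. Qed.

Lemma limg_sub_incl M (U : submod M) : limg (sub_incl U) = U.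
Proof.
apply/vspaceP => v; apply/memv_imgP/idP => [[u _ ->]|vU].
  by rewrite sub_inclE subvsP.
by exists (vsproj U v); rewrite ?memvf // sub_inclE vsprojK.
Qed.

Lemma quot_proj_subproof M (U : submod M) :
  quot_pi U \in @equivariant k A M (quot_mod U).
Proof. by apply/asboolP => a v; rewrite [RHS]quot_actE. Qed.

Definition quot_proj M (U : submod M) : hom M (quot_mod U) :=
  MkHom (quot_proj_subproof U).

Lemma lker_quot_proj M (U : submod M) : lker (quot_proj U) = U.
Proof. exact: lker_quot_pi. Qed.

Lemma limg_quot_proj M (U : submod M) : limg (quot_proj U) = fullv.
Proof. exact: limg_quot_pi. Qed.

Lemma sub_quot_exact M (U : submod M) : short_exact (sub_incl U) (quot_proj U).
Proof.
by split; rewrite ?lker_sub_incl ?limg_sub_incl ?lker_quot_proj ?limg_quot_proj.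
Qed.

Lemma img_submod_stable M N (f : hom M N) (U : submod M) :
  (f @: U)%VS \in @stable k A N.
Proof.
apply/asboolP => a _ /memv_imgP[u uU ->].
by rewrite -homP memv_img ?submodP.
Qed.
Definition img_submod M N (f : hom M N) (U : submod M) : submod N :=
  Submod (img_submod_stable f U).

Lemma preim_submod_stable M N (f : hom M N) (U : submod N) :
  (f @^-1: U)%VS \in @stable k A M.
Proof.
apply/asboolP => a u; rewrite -!memv_preim => uU; rewrite homP.
exact: submodP.
Qed.
Definition preim_submod M N (f : hom M N) (U : submod N) : submod M :=
  Submod (preim_submod_stable f U).

Lemma zero_stable M : (0%VS : {vspace M}) \in @stable k A M.
Proof. by apply/asboolP => a u; rewrite !memv0 => /eqP->; rewrite linear0. Qed.
Definition zero_submod M : submod M := Submod (zero_stable M).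

Definition ker_submod M N (f : hom M N) : submod M :=
  preim_submod f (zero_submod N).

Lemma ker_submodE M N (f : hom M N) : (ker_submod f : {vspace M}) = lker f.
Proof. exact: lpreim0. Qed.

(** The third isomorphism theorem for j(U) <= j(X) <= M, with j(X) / j(U) presented
    as X / U: the layers of the radical series are quotients of [rad_pow], which
    is only embedded in the module. *)
Lemma quot_exact M X (j : hom X M) (U : submod X) (V W : submod M) :
  lker j = 0%VS -> (V : {vspace M}) = (j @: U)%VS -> (W : {vspace M}) = limg j ->
  exists (f : hom (quot_mod U) (quot_mod V)) (g : hom (quot_mod V) (quot_mod W)),
    short_exact f g.
Proof.
move=> j0 VE WE.
have jI : injective j by apply/lker0P; rewrite j0.
have [|f fE] := @hom_desc _ _ _ (quot_proj U) (hom_comp (quot_proj V) j)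
  (limg_quot_proj U).
  apply/subvP => x; rewrite lker_quot_proj memv_ker hom_compE -memv_ker.
  by rewrite lker_quot_proj VE; apply: memv_img.
have [|g gE] := @hom_desc _ _ _ (quot_proj V) (quot_proj W) (limg_quot_proj V).
  by rewrite !lker_quot_proj VE WE limgS ?subvf.
have fE' x : f (quot_proj U x) = quot_proj V (j x) by rewrite -!hom_compE fE.
have gE' x : g (quot_proj V x) = quot_proj W x by rewrite -gE hom_compE.
have sU y : exists x, y = quot_proj U x.
  have : y \in limg (quot_proj U) by rewrite limg_quot_proj memvf.
  by case/memv_imgP => x _ ->; exists x.
have sV y : exists x, y = quot_proj V x.
  have : y \in limg (quot_proj V) by rewrite limg_quot_proj memvf.
  by case/memv_imgP => x _ ->; exists x.
exists f, g; split.
- apply/eqP; rewrite -subv0; apply/subvP => y; have [x ->] := sU y.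
  rewrite memv_ker fE' -memv_ker lker_quot_proj VE memv0 => /memv_imgP[u uU /jI ->].
  by rewrite -memv_ker lker_quot_proj.
- apply/vspaceP => y; apply/memv_imgP/idP => [[z _ ->]|].
    have [x ->] := sU z; rewrite memv_ker fE' gE' -memv_ker lker_quot_proj WE.
    by rewrite memv_img ?memvf.
  have [x ->] := sV y; rewrite memv_ker gE' -memv_ker lker_quot_proj WE.
  by move/memv_imgP=> [z _ xE]; exists (quot_proj U z); rewrite ?memvf ?fE' ?xE.
apply/eqP; rewrite eqEsubv subvf -(limg_quot_proj W); apply/subvP.
by move=> _ /memv_imgP[x _ ->]; rewrite -gE' memv_img ?memvf.
Qed.

(** Projectivity of [P] makes Hom(P, -) exact on the right. *)
Lemma hdim_exact P M N Q (f : hom M N) (g : hom N Q) :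
  projective P -> short_exact f g -> hdim P N = (hdim P M + hdim P Q)%N.
Proof.
move=> projP [f0 fg gS].
pose phiM := GRing.isLinear.Build k (hom P M) (hom P N) *:%R _ (hom_comp_linearr f).
pose phi : {linear hom P M -> hom P N} := HB.pack (@hom_comp k A P M N f) phiM.
pose psiM := GRing.isLinear.Build k (hom P N) (hom P Q) *:%R _ (hom_comp_linearr g).
pose psi : {linear hom P N -> hom P Q} := HB.pack (@hom_comp k A P N Q g) psiM.
rewrite /hdim -(limg_ker_dim (linfun psi) fullv) capfv.
have -> : limg (linfun psi) = fullv.
  apply/vspaceP => h; rewrite memvf; have [h' <-] := projP _ _ g h gS.
  by apply/memv_imgP; exists h'; rewrite ?memvf // lfunE.
congr (_ + _)%N.
have -> : lker (linfun psi) = limg (linfun phi).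
  apply/vspaceP => h; rewrite memv_ker lfunE /=; apply/eqP/memv_imgP => [gh|[h' _ ->]].
    have [|h' <-] := @hom_lift _ _ _ f h f0; last first.
      by exists h'; [exact: memvf | rewrite (lfunE phi)].
    rewrite fg; apply/subvP => _ /memv_imgP[x _ ->].
    by rewrite memv_ker -hom_compE gh hom0E.
  apply: hom_eqP => x; rewrite (lfunE phi) (hom_compE g) (hom_compE f) hom0E; apply/eqP.
  by rewrite -memv_ker -fg memv_img ?memvf.
apply: limg_dim_eq; apply/eqP; rewrite capfv -subv0; apply/subvP => h.
rewrite memv_ker lfunE memv0 /= => /eqP fh0; apply/eqP/hom_eqP => x.
by apply/eqP; rewrite hom0E -memv0 -f0 memv_ker -hom_compE fh0 hom0E.
Qed.

End HomSpaces.

(** * Functoriality of the radical and Loewy length *)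

Section Radical.

Variables (k : fieldType) (A : falgType k).
Implicit Types M N Q X Y S T : fdmod A.

Lemma simple_semisimple M : simple M -> semisimple M.
Proof.
move=> [M0 sM]; exists 1%N, (fun _ => fullmod M); split; last by rewrite big_ord1.
  by move=> _; apply/simple_subP; split=> // V _; apply: sM.
by rewrite directvE /= !big_ord1.
Qed.

Lemma rad_le_maximal M (K : submod M) : sfac K (fullmod M) -> (rad M <= K)%VS.
Proof.
move=> [_ Kf maxK]; apply: (radP M).2; apply/simple_semisimple/simple_quot.
  exact/eqP.
by move=> W KW; apply: maxK => //; apply: subvf.
Qed.

(** The preimage of a maximal submodule is everything or maximal, and the radical
    of [N] is the intersection of its maximal submodules. *)
Lemma hom_rad M N (f : hom M N) : (f @: rad M <= rad N)%VS.
Proof.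
apply: (semisimple_le (R := img_submod f (rad M)) (radP N).1) => K maxK _ /=.
have [fK|fK] := eqVneq (f @^-1: K)%VS fullv.
  apply/subvP => _ /memv_imgP[u _ ->].
  by rewrite memv_preim fK memvf.
suff : sfac (preim_submod f K) (fullmod M).
  move/rad_le_maximal/subvP => radK; apply/subvP => _ /memv_imgP[u /radK uK ->].
  by rewrite memv_preim.
split=> [||X KX _]; [exact: subvf | exact/eqP |].
have [_ _] := maxK => /(_ (Submod (addm_stable K (img_submod f X)))).
rewrite /= addvSl subvf => /(_ isT isT) [KfX|KfX]; [left|right]; apply/eqP.
  rewrite eqEsubv KX andbT; apply/subvP => x xX.
  by rewrite /= -memv_preim -KfX (subvP (addvSr _ _)) // memv_img.
rewrite eqEsubv subvf; apply/subvP => m _.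
have /memv_addP[c cK [_ /memv_imgP[x xX ->] mE]] : f m \in (K + f @: X)%VS.
  by rewrite KfX memvf.
rewrite -(subrK x m) rpredD // (subvP KX) //= -memv_preim linearB /= mE addrK.
exact: cK.
Qed.

Lemma hom_rad_restrict M N (f : hom M N) :
  exists g : hom (sub_mod (rad M)) (sub_mod (rad N)),
    hom_comp (sub_incl (rad N)) g = hom_comp f (sub_incl (rad M)).
Proof.
apply: hom_lift; first exact: lker_sub_incl.
rewrite limg_sub_incl limg_comp limg_sub_incl; exact: hom_rad.
Qed.

(** The zero submodule of [S] is maximal. *)
Lemma rad_simple S : simple S -> (rad S : {vspace S}) = 0%VS.
Proof.
move=> [S0 sS]; apply/eqP; rewrite -subv0.
apply: (rad_le_maximal (K := zero_submod S)); split=> [||X _ _]; rewrite ?sub0v //=.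
by move/esym.
Qed.

Fixpoint rad_incl s M : hom (rad_pow s M) M :=
  if s is s'.+1 then hom_comp (rad_incl s' M) (sub_incl (rad (rad_pow s' M)))
  else hom_id M.

Lemma lker_comp M N Q (g : hom N Q) (f : hom M N) :
  lker g = 0%VS -> lker f = 0%VS -> lker (hom_comp g f) = 0%VS.
Proof.
move=> g0 f0; apply/eqP/lker0P => x y; rewrite !hom_compE.
have gI : injective g by apply/lker0P; rewrite g0.
have fI : injective f by apply/lker0P; rewrite f0.
by move=> /gI/fI.
Qed.

Lemma lker_rad_incl s M : lker (rad_incl s M) = 0%VS.
Proof.
elim: s => [|s IH]; last exact: lker_comp IH (lker_sub_incl _).
by apply/eqP/lker0P => x y; rewrite !hom_idE.
Qed.

(** Equivalent to rad^s(X) = 0 by functoriality of the radical; quantifying over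
    the maps into [X] is the form in which it is used. *)
Definition loewy_le s X : Prop :=
  forall Y (f : hom Y X), hom_comp f (rad_incl s Y) = 0.

(** [rad_pow] takes the new radical of the previous power; this is the comparison
    with the powers of the radical started one step inside [M]. *)
Lemma rad_incl_inner s M :
  exists f : hom (rad_pow s.+1 M) (rad_pow s (sub_mod (rad M))),
    hom_comp (sub_incl (rad M)) (hom_comp (rad_incl s _) f) = rad_incl s.+1 M.
Proof.
elim: s => [|s [f fE]].
  by exists (hom_id _); apply: hom_eqP => x; rewrite !hom_compE !hom_idE.
have [g gE] := hom_rad_restrict f; exists g; apply: hom_eqP => x.
have gE' : sub_incl _ (g x) = f (sub_incl _ x) by rewrite -!hom_compE gE.
have := congr1 (fun u : hom _ _ => u (sub_incl _ x)) fE.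
by rewrite !hom_compE gE'.
Qed.

(** The radical is contained in the kernel of any map to a module of Loewy
    length at most 1, so every map into the middle term, restricted to the radical of its
    source, lands in the submodule. *)
Lemma loewy_ext s M N Q (f : hom M N) (g : hom N Q) :
  short_exact f g -> loewy_le s M -> loewy_le 1 Q -> loewy_le s.+1 N.
Proof.
move=> [f0 fg _] sM sQ Y h; have [phi <-] := rad_incl_inner s Y.
have [||h' h'E] := @hom_lift _ _ _ _ _ f (hom_comp h (sub_incl (rad Y))) => //.
  rewrite fg; apply/subvP => _ /memv_imgP[y _ ->]; rewrite memv_ker hom_compE.
  have := congr1 (fun u : hom _ _ => u y) (sQ Y (hom_comp g h)).
  by rewrite !hom_compE hom_idE hom0E => ->.
apply: hom_eqP => y; rewrite hom0E !hom_compE.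
rewrite -[h _](hom_compE h) -h'E hom_compE.
have := congr1 (fun u : hom _ _ => u (phi y)) (sM _ h').
by rewrite hom_compE hom0E => ->; rewrite linear0.
Qed.

Definition radical_submod s M : submod M :=
  img_submod (rad_incl s M) (fullmod (rad_pow s M)).

Definition truncation s M : fdmod A := quot_mod (radical_submod s M).

(** The layer is rad^s / rad^(s+1), the kernel of M / rad^(s+1) -> M / rad^s. *)
Lemma truncation_exact s M :
  exists (f : hom (rad_layer s.+1 M) (truncation s.+1 M))
         (g : hom (truncation s.+1 M) (truncation s M)), short_exact f g.
Proof.
apply: (@quot_exact _ _ _ _ (rad_incl s M)) => //; first exact: lker_rad_incl.
by rewrite /= limg_comp limg_sub_incl.
Qed.

Lemma loewy_factor s M X (f : hom M X) : loewy_le s X ->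
  exists g : hom (truncation s M) X, hom_comp g (quot_proj (radical_submod s M)) = f.
Proof.
move=> sX; apply: hom_desc; first exact: limg_quot_proj.
rewrite lker_quot_proj; apply/subvP => _ /memv_imgP[y _ ->].
by rewrite memv_ker -hom_compE sX hom0E.
Qed.

Lemma simple_img M S (f : hom M S) : simple S -> f <> 0 -> limg f = fullv.
Proof.
move=> [_ /(_ (img_submod f (fullmod M))) [fM|//]] [].
apply: hom_eqP => x; apply/eqP; rewrite hom0E -memv0 -[0%VS]fM.
by rewrite memv_img ?memvf.
Qed.

Lemma simple_ker S M (f : hom S M) : simple S -> f <> 0 -> lker f = 0%VS.
Proof.
move=> [_ /(_ (ker_submod f))]; rewrite ker_submodE => -[//|fM] [].
by apply: hom_eqP => x; apply/eqP; rewrite hom0E -memv_ker fM memvf.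
Qed.

Lemma schur_iso S T (f : hom S T) : simple S -> simple T -> f <> 0 -> iso S T.
Proof.
by move=> sS sT f0; exists f; apply: hom_bij; [apply: simple_ker|apply: simple_img].
Qed.

(** The image of [X] in the simple module [S] is zero or everything. *)
Lemma ker_maximal M S (f : hom M S) (X : submod M) : simple S -> f <> 0 ->
  (lker f <= X)%VS -> (X : {vspace M}) = lker f \/ (X : {vspace M}) = fullv.
Proof.
move=> sS f0 fX; have fS := simple_img sS f0.
have [_ /(_ (img_submod f X)) /= [fX0|fXS]] := sS; [left|right]; apply/eqP.
  by rewrite eqEsubv fX andbT lkerE fX0.
rewrite eqEsubv subvf; apply/subvP => m _.
have /memv_imgP[x xX mE] : f m \in (f @: X)%VS by rewrite fXS memvf.
rewrite -(subrK x m) rpredD // (subvP fX) // memv_ker linearB /= mE subrr.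
exact: eqxx.
Qed.

(** The superfluous kernel of the cover is contained in every maximal submodule,
    in particular in the kernel of every map to a simple module. *)
Lemma cover_factor P L (hP : projective_cover P L) :
  exists f : hom P L, limg f = fullv /\
    forall S (g : hom P S), simple S -> exists e : hom L S, hom_comp e f = g.
Proof.
have [_ [f [fS fsup]]] := hP; exists f; split=> // S g sS.
have [->|g0] := pselect (g = 0); first by exists 0; apply: hom_comp0.
apply: hom_desc => //.
have fg : (lker g <= Submod (addm_stable (ker_submod g) (ker_submod f)))%VS.
  by rewrite /= !lpreim0 addvSl.
case: (ker_maximal sS g0 fg); rewrite /= !lpreim0 => gf.
  by rewrite -gf addvSr.
have := fsup (ker_submod g); rewrite ker_submodE => /(_ gf) gf'.
by case: g0; apply: hom_eqP => x; apply/eqP; rewrite hom0E -memv_ker gf' memvf.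
Qed.

End Radical.

Section Schur.

Variables (k : closedFieldType) (A : falgType k).
Implicit Types M N P L S T : fdmod A.

(** The characteristic polynomial has a root. *)
Lemma endo_eigenvector (V : vectType k) (f : 'End(V)) : {:V}%VS != 0%VS ->
  exists c : k, exists2 v : V, v != 0 & f v = c *: v.
Proof.
move=> V0; set e := vbasis {:V}.
have eB : basis_of {:V} e by apply: vbasisP.
have [|c] := closed_rootP (char_poly (passmx.mxof e e f)) _.
  by rewrite size_char_poly eqSS dimv_eq0.
rewrite -eigenvalue_root_char => ec.
have E0 : (passmx.leigenspace f c != 0)%VS.
  by rewrite (passmx.leigenspaceE eB) passmx.vsof_eq0 ?(basis_free eB).
exists c, (vpick (passmx.leigenspace f c)); first by rewrite vpick0.
have := memv_pick (passmx.leigenspace f c).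
by rewrite memv_ker add_lfunE opp_lfunE scale_lfunE id_lfunE subr_eq0 => /eqP.
Qed.

(** Schur's lemma: an endomorphism minus one of its eigenvalues is not
    injective, hence is zero. *)
Lemma hdim_simple_end L : simple L -> hdim L L = 1%N.
Proof.
move=> sL; have L0 : (fullv : {vspace L}) != 0%VS by apply/eqP; case: sL.
suff E : (fullv : {vspace hom L L}) = <[hom_id L]>%VS.
  rewrite /hdim E dim_vline; case: eqP => //= id0; case/eqP: L0; apply/eqP.
  rewrite -subv0; apply/subvP => v _; rewrite memv0 -[v]hom_idE id0.
  by rewrite hom0E.
apply/vspaceP => f; rewrite memvf; apply/esym.
have [c [v v0 fv]] := endo_eigenvector f L0; apply/vlineP; exists c.
apply: contrapT => fc; case/negP: v0.
have fc0 : f - c *: hom_id L <> 0 by move/subr0_eq.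
rewrite -memv0 -(simple_ker sL fc0) memv_ker.
by rewrite /= add_lfunE opp_lfunE scale_lfunE id_lfunE fv subrr.
Qed.

Lemma hdim_cover P L S (hP : projective_cover P L) : simple L -> simple S ->
  hdim P S = `[< iso S L >].
Proof.
move=> sL sS; have [f [fS fP]] := cover_factor hP.
have fE M (e : hom L M) : hom_comp e f = 0 -> e = 0.
  move=> ef; apply: hom_eqP => y; rewrite hom0E.
  have /memv_imgP[x _ ->] : y \in limg f by rewrite fS memvf.
  by rewrite -hom_compE ef hom0E.
have -> : hdim P S = hdim L S.
  apply/eqP; rewrite eqn_leq; apply/andP; split.
    by apply: hdim_le_surj (hom_comp_linearl f) _ => g; apply: fP.
  by apply: hdim_le_inj (hom_comp_linearl f) _ => e; apply: fE.
case: asboolP => [SL|nSL]; first by rewrite (hdim_iso _ SL) hdim_simple_end.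
apply/eqP; rewrite dimv_eq0 -subv0; apply/subvP => e _; rewrite memv0.
by apply/eqP; apply: contrapT => e0; apply: nSL; apply/iso_sym/(schur_iso sL sS e0).
Qed.

End Schur.

(** * Dualities fixing the simple modules *)

Section Duality.

Variables (k : fieldType) (A : falgType k) (d : duality A).
Implicit Types M N X Y S : fdmod A.

Lemma dual_map0 M N : dual_map d (0 : hom M N) = 0.
Proof.
have := dual_linear d (-1) (0 : hom M N) 0.
by rewrite !scaleN1r oppr0 addr0 addNr.
Qed.

(** A duality is faithful since its square is isomorphic to the identity. *)
Lemma dual_map_eq0 M N (f : hom M N) : dual_map d f = 0 -> f = 0.
Proof.
move=> f0; have := dual_eta_natural d f; rewrite f0 dual_map0 hom_comp0 => nf.
have etaI := bij_inj (dual_eta_bij d N).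
apply: hom_eqP => v; apply: etaI.
by rewrite -hom_compE nf !hom0E linear0.
Qed.

Lemma dual_zero M : (fullv : {vspace M}) = 0%VS -> (fullv : {vspace d M}) = 0%VS.
Proof.
move=> M0; have id0 : hom_id M = 0.
  by apply: hom_eqP => v; apply/eqP; rewrite hom0E -memv0 -M0 memvf.
apply/eqP; rewrite -subv0; apply/subvP => v _.
by rewrite memv0 -[v]hom_idE -dual_id id0 dual_map0 hom0E.
Qed.

(** Transposing f : M -> d(N) gives d(f) o eta : N -> d(M), which determines f
    because eta is bijective and [d] faithful.  Exchanging [M] and [N] gives equality. *)
Lemma hdim_dual_le M N : (hdim M (d N) <= hdim N (d M))%N.
Proof.
pose phi (f : hom M (d N)) := hom_comp (dual_map d f) (dual_eta d N).
apply: (@hdim_le_inj _ _ _ _ _ _ phi) => [c f g|f f0].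
  by rewrite /phi dual_linear; apply: hom_comp_linearl.
apply/dual_map_eq0/hom_eqP => v; rewrite hom0E.
have [eta' _ etaK] := dual_eta_bij d N.
by rewrite -[v]etaK -hom_compE -/(phi f) f0 hom0E.
Qed.

(** The radical of [S] is zero and homomorphisms preserve radicals. *)
Lemma loewy_simple S : simple S -> loewy_le 1 S.
Proof.
move=> sS Y f; apply: hom_eqP => y; apply/eqP; rewrite hom0E -memv0.
rewrite -(rad_simple sS) (subvP (hom_rad f)) // !hom_compE hom_idE memv_img //.
by rewrite sub_inclE subvsP.
Qed.

Hypothesis dS : forall S, simple S -> iso (d S) S.

(** If M is the sum of simple S_i, a map into d(M) vanishes once its composites
    with all d(M) -> d(S_i) do, by faithfulness applied to the dual map; and each
    d(S_i), being simple, kills radicals. *)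
Lemma loewy_dual_semisimple M : semisimple M -> loewy_le 1 (d M).
Proof.
move=> [n [S [simS _ SM]]] Y f; set g := hom_comp f _.
have Sg i : hom_comp (dual_map d (sub_incl (S i))) g = 0.
  have [e /bij_inj eI] := dS (simS i).
  have := loewy_simple (simS i) (hom_comp e (hom_comp (dual_map d (sub_incl (S i))) f)).
  move=> e0; apply: hom_eqP => y; apply: eI; rewrite hom0E linear0.
  have := congr1 (fun u : hom _ _ => u y) e0; rewrite hom0E => <-.
  by rewrite /g !hom_compE.
have gS i x : dual_map d g (dual_eta d M (sub_incl (S i) x)) = 0.
  rewrite -[dual_eta d _ _]hom_compE dual_eta_natural hom_compE -hom_compE -dual_comp.
  by rewrite Sg dual_map0 hom0E.
apply: dual_map_eq0; apply: hom_eqP => v; rewrite hom0E.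
have [eta' _ etaK] := dual_eta_bij d M; rewrite -[v]etaK; move: (eta' v) => {v etaK} m.
have /memv_sumP[s sS ->] : m \in (\sum_(i < n) (S i : {vspace M}))%VS.
  by rewrite SM memvf.
rewrite !linear_sum big1 // => i _; set w := s i.
have : w \in limg (sub_incl (S i)) by rewrite limg_sub_incl sS.
case/memv_imgP => x _ ->; exact: gS.
Qed.

(** Dualizing reverses the exact sequence of [truncation_exact], so the dual of
    the semisimple layer becomes the quotient and [loewy_ext] applies. *)
Lemma loewy_dual_truncation s M : loewy_le s (d (truncation s M)).
Proof.
elim: s => [|s IHs].
  have T0 : (fullv : {vspace truncation 0 M}) = 0%VS.
    rewrite -(limg_quot_proj (radical_submod 0 M)); apply/eqP.
    rewrite -lkerE lker_quot_proj; apply/subvP => v _.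
    by rewrite -[v]hom_idE memv_img ?memvf.
  move=> Y f; apply: hom_eqP => y; apply/eqP.
  by rewrite hom0E -memv0 -(dual_zero T0) memvf.
have [f [g fg]] := truncation_exact s M.
apply: loewy_ext (dual_exact d fg) IHs _.
exact/loewy_dual_semisimple/(radP _).1.
Qed.

End Duality.

Section Symmetry.

Variables (k : closedFieldType) (A : falgType k).
Variables (pi : Type) (L P : pi -> fdmod A).
Hypothesis hL : full_set_of_simples L.
Hypothesis hP : forall l, projective_cover (P l) (L l).
Implicit Types M N X : fdmod A.

(** Both sides are additive along a composition series and agree on its simple
    factors.  The right-hand side does not see the series, which is how the
    independence of its choice enters. *)
Lemma mult_hdim M l : mult M (L l) = hdim (P l) M.
Proof.
have [sL _ _] := hL; rewrite /mult; case: cid => s /= [fs].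
elim: fs => {M s} [M M0|M U s _ IH] /=; first by rewrite hdim_zero.
case/andP => /asboolP sMU /IH ->.
rewrite (hdim_exact (hP l).1 (sub_quot_exact U)) addnC; congr (_ + _)%N.
by rewrite (hdim_cover (hP l)).
Qed.

Variable d : duality A.
Hypothesis dL : forall l, iso (d (L l)) (L l).

(** The hypothesis on [d] is about the chosen representatives; functoriality
    transports it to all simple modules. *)
Lemma dual_simple_iso S : simple S -> iso (d S) S.
Proof.
have [_ _ allL] := hL; move=> /allL[l SL].
apply: iso_trans (iso_sym SL); apply: iso_trans (dL l).
have [f fB] := iso_sym SL; exists (dual_map d f).
have [g [gf fg]] : exists g, hom_comp g f = hom_id _ /\ hom_comp f g = hom_id _.
  have [|g fg] := @hom_lift _ _ _ _ _ f (hom_id _) (hom_bij_ker fB).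
    by rewrite (hom_bij_img fB) subvf.
  exists g; split=> //; apply: hom_eqP => x; apply: (bij_inj fB).
  by rewrite hom_compE -[LHS](hom_compE f) fg !hom_idE.
by exists (dual_map d g) => x; rewrite -hom_compE -dual_comp ?gf ?fg dual_id hom_idE.
Qed.

(** Induction along a composition series: exactness of [d] reverses each step, and
    the simple factors are fixed by [d]. *)
Lemma hdim_dual M l : hdim (P l) (d M) = hdim (P l) M.
Proof.
have [s [fs ss]] := exists_comp_series M.
elim: fs ss => {M s} [M M0|M U s _ IH] /=.
  by rewrite !hdim_zero //; apply: dual_zero.
case/andP => /asboolP sMU /IH UE; have exU := sub_quot_exact U.
rewrite (hdim_exact (hP l).1 exU) (hdim_exact (hP l).1 (dual_exact d exU)) UE addnC.
by rewrite (hdim_iso _ (dual_simple_iso sMU)).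
Qed.

(** With T_s M for [truncation s M], this is the chain
      dim Hom(P l, d(T_s P m)) <= dim Hom(T_s P l, d(T_s P m))
        <= dim Hom(T_s P m, d(T_s P l)) <= dim Hom(P m, d(T_s P l)),
    whose two ends are the required dimensions since [d] preserves multiplicities. *)
Lemma hdim_truncation_le s l m :
  (hdim (P l) (truncation s (P m)) <= hdim (P m) (truncation s (P l)))%N.
Proof.
rewrite -hdim_dual -[leqRHS]hdim_dual.
set T := truncation s (P m).
have sT : loewy_le s (d T) by apply: loewy_dual_truncation dual_simple_iso _ _.
apply: (@leq_trans (hdim (truncation s (P l)) (d T))).
  by apply: hdim_le_surj (hom_comp_linearl (quot_proj _)) _ => f; apply: loewy_factor.
apply: leq_trans (hdim_dual_le d _ _) _.
apply: hdim_le_inj (hom_comp_linearl (quot_proj _)) _ => f f0.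
apply: hom_eqP => y; have : y \in limg (quot_proj (radical_submod s (P m))).
  by rewrite limg_quot_proj memvf.
by case/memv_imgP => x _ ->; rewrite -hom_compE f0 !hom0E.
Qed.

(** Multiplicities in a layer are differences of multiplicities in two consecutive
    truncations, both of which are symmetric. *)
Lemma rad_layer_sym s l m :
  mult (rad_layer s.+1 (P m)) (L l) = mult (rad_layer s.+1 (P l)) (L m).
Proof.
have layerE l' m' : (hdim (P l') (truncation s.+1 (P m')) =
    hdim (P l') (rad_layer s.+1 (P m')) + hdim (P l') (truncation s (P m')))%N.
  by have [f [g /(hdim_exact (hP l').1)]] := truncation_exact s (P m').
have truncE r : hdim (P l) (truncation r (P m)) = hdim (P m) (truncation r (P l)).
  by apply/eqP; rewrite eqn_leq !hdim_truncation_le.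
rewrite !mult_hdim; apply/eqP; rewrite -(eqn_add2r (hdim (P l) (truncation s (P m)))).
by rewrite -layerE !truncE -layerE.
Qed.

End Symmetry.

(** * The linear dual twisted by an anti-involution *)

Section LinearDual.

Variable k : fieldType.
Implicit Types U V W : vectType k.

Definition ldual V : vectType k := 'Hom(V, k^o).

Section Transpose.
Variables (U V : vectType k) (f : 'Hom(U, V)).
Definition precomp (phi : ldual V) : ldual U := (phi \o f)%VF.
Fact precomp_linear : linear precomp.
Proof.
by move=> c phi psi; rewrite /precomp comp_lfunDl comp_lfunZl.
Qed.
HB.instance Definition _ :=
  GRing.isLinear.Build k (ldual V) (ldual U) *:%R precomp precomp_linear.
Definition transpose : 'Hom(ldual V, ldual U) := linfun precomp.
Lemma transposeE phi v : transpose phi v = phi (f v).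
Proof. by rewrite lfunE /= comp_lfunE. Qed.
End Transpose.

Lemma dim_ldual V : \dim {:ldual V} = \dim {:V}.
Proof. rewrite !dimvf; exact: muln1. Qed.

Section Bidual.
Variable V : vectType k.
Definition eval_at (v : V) (phi : ldual V) : k^o := phi v.
Fact eval_at_linear v : linear (eval_at v).
Proof. by move=> c phi psi; rewrite /eval_at add_lfunE scale_lfunE. Qed.
HB.instance Definition _ v :=
  GRing.isLinear.Build k (ldual V) k^o *:%R (eval_at v) (eval_at_linear v).
Definition bidual_fun (v : V) : ldual (ldual V) := linfun (eval_at v).
Fact bidual_linear : linear bidual_fun.
Proof.
move=> c u v; apply/lfunP => phi.
by rewrite add_lfunE scale_lfunE !lfunE /= /eval_at linearP.
Qed.
HB.instance Definition _ :=
  GRing.isLinear.Build k V (ldual (ldual V)) *:%R bidual_fun bidual_linear.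
Definition bidual : 'Hom(V, ldual (ldual V)) := linfun bidual_fun.

Lemma bidualE v phi : bidual v phi = phi v.
Proof. by rewrite lfunE /= lfunE. Qed.

(** Some coordinate of a nonzero vector is nonzero. *)
Lemma functional_sep (v : V) : v != 0 -> exists phi : ldual V, phi v = 1.
Proof.
move=> v0; have [i ci] : exists i, coord (vbasis {:V}) i v != 0.
  apply: contrapT => noi; case/eqP: v0.
  rewrite (coord_vbasis (memvf v)) big1 // => i _.
  have [->|ci] := eqVneq (coord (vbasis {:V}) i v) 0; first by rewrite scale0r.
  by case: noi; exists i.
exists ((coord (vbasis {:V}) i v)^-1 *: linfun (coord (vbasis {:V}) i : V -> k^o)).
by rewrite scale_lfunE lfunE /= [LHS]mulVf.
Qed.


Lemma bidual_ker : lker bidual = 0%VS.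
Proof.
apply/eqP; rewrite -subv0; apply/subvP => v; rewrite memv_ker memv0 => /eqP v0.
apply: contraT => /functional_sep[phi]; rewrite -bidualE v0 zero_lfunE => /eqP.
by rewrite eq_sym oner_eq0.
Qed.

(** [bidual] is injective and both spaces have the same dimension. *)
Lemma bidual_img : limg bidual = fullv.
Proof.
apply/eqP; rewrite eqEdim subvf limg_dim_eq ?bidual_ker ?capv0 //.
by rewrite !dim_ldual leqnn.
Qed.
End Bidual.

(** Both families define linear maps out of the coordinate space of [I]; the
    second factors through the first, by a right inverse of the latter on its
    image. *)
Lemma lfun_of_relations (I : finType) V W (y : I -> V) (z : I -> W) :
  (forall c : I -> k, \sum_i c i *: y i = 0 -> \sum_i c i *: z i = 0) ->
  exists f : 'Hom(V, W), forall i, f (y i) = z i.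
Proof.
move=> yz.
pose comb (X : vectType k) (x : I -> X) (c : {ffun I -> k^o}) : X := \sum_i (c i : k) *: x i.
have combL (X : vectType k) (x : I -> X) : linear (comb X x).
  move=> a c c'; rewrite /comb scaler_sumr -big_split; apply: eq_bigr => i _ /=.
  by rewrite !ffunE scalerDl scalerA.
pose lin (X : vectType k) (x : I -> X) : {linear {ffun I -> k^o} -> X} :=
  HB.pack (comb X x) (GRing.isLinear.Build k _ _ *:%R (comb X x) (combL X x)).
have combE (X : vectType k) (x : I -> X) c : linfun (lin X x) c = comb X x c.
  exact: (lfunE (lin X x)).
pose p := linfun (lin V y); pose q := linfun (lin W z).
exists (q \o p^-1)%VF => i.
pose e : {ffun I -> k^o} := [ffun j => ((j == i)%:R : k)].
have eE (X : vectType k) (x : I -> X) : comb X x e = x i.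
  rewrite /comb (bigD1 i) //= ffunE eqxx scale1r big1 ?addr0 // => j ji.
  by rewrite ffunE (negbTE ji) scale0r.
set c := (p^-1)%VF (y i) - e.
have pc : comb V y c = 0.
  rewrite -combE linearB /= -/p limg_lfunVK ?combE ?eE ?subrr //.
  by rewrite -(eE V y) -combE memv_img ?memvf.
have := yz (fun j => c j) pc; rewrite -/(comb W z c) -combE linearB /= => /eqP.
by rewrite subr_eq0 comp_lfunE combE -/q => /eqP->; rewrite combE eE.
Qed.

End LinearDual.

Section TwistedDual.

Variables (k : fieldType) (A : falgType k) (inv : 'End(A)).
Hypothesis invM : forall a b, inv (a * b) = inv b * inv a.
Hypothesis invK : involutive inv.
Implicit Types M N Q : fdmod A.

Lemma inv1 : inv 1 = 1.
Proof. by have := invM 1 (inv 1); rewrite mul1r invK mul1r => <-. Qed.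

Section Module.
Variable M : fdmod A.
(** Precomposition makes the dual a right module; the anti-involution turns this
    into a left action. *)
Definition twist_act (a : A) : 'End(ldual M) := transpose (act M (inv a)).
Lemma twist_actE a phi v : twist_act a phi v = phi (act M (inv a) v).
Proof. exact: transposeE. Qed.
Lemma twist_act_linear : linear twist_act.
Proof.
move=> c a b; apply/lfunP => phi; apply/lfunP => v.
rewrite !add_lfunE !scale_lfunE !twist_actE.
by rewrite (linearP inv) act_linear add_lfunE scale_lfunE linearP.
Qed.
Lemma twist_act1 : twist_act 1 = \1%VF.
Proof.
apply/lfunP => phi; apply/lfunP => v.
by rewrite twist_actE inv1 act1 !id_lfunE.
Qed.
Lemma twist_actM a b : twist_act (a * b) = (twist_act a \o twist_act b)%VF.
Proof.
apply/lfunP => phi; apply/lfunP => v.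
by rewrite comp_lfunE !twist_actE invM actM comp_lfunE.
Qed.
Definition twist_dual : fdmod A := FdMod twist_act_linear twist_act1 twist_actM.
End Module.

Lemma twist_map_subproof M N (f : hom M N) :
  transpose f \in @equivariant k A (twist_dual N) (twist_dual M).
Proof.
apply/asboolP => a phi; apply/lfunP => v.
by rewrite transposeE !twist_actE transposeE homP.
Qed.
Definition twist_map M N (f : hom M N) : hom (twist_dual N) (twist_dual M) :=
  MkHom (twist_map_subproof f).

Lemma twist_mapE M N (f : hom M N) (phi : twist_dual N) v : 
  (twist_map f phi : ldual M) v = (phi : ldual N) (f v).
Proof. exact: transposeE. Qed.

Lemma twist_id M : twist_map (hom_id M) = hom_id (twist_dual M).
Proof.
by apply: hom_eqP => phi; apply/lfunP => v; rewrite twist_mapE !hom_idE.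
Qed.

Lemma twist_comp M N Q (g : hom N Q) (f : hom M N) :
  twist_map (hom_comp g f) = hom_comp (twist_map f) (twist_map g).
Proof.
apply: hom_eqP => phi; apply/lfunP => v.
by rewrite hom_compE !twist_mapE hom_compE.
Qed.

Lemma twist_linear M N : linear (@twist_map M N).
Proof.
move=> c f g; apply: hom_eqP => phi; apply/lfunP => v.
rewrite hom_addE hom_scaleE twist_mapE hom_addE hom_scaleE linearP.
by rewrite add_lfunE scale_lfunE !twist_mapE.
Qed.

(** A functional on a submodule extends, and a functional killing the kernel of a
    surjection descends, by composing with the linear map [^-1]. *)
Lemma twist_exact M N Q (f : hom M N) (g : hom N Q) :
  short_exact f g -> short_exact (twist_map g) (twist_map f).
Proof.
move=> [f0 fg gS]; split.
- apply/eqP; rewrite -subv0; apply/subvP => phi; rewrite memv_ker memv0.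
  move=> /eqP/lfunP phi0; apply/eqP/lfunP => q.
  have /memv_imgP[v _ ->] : q \in limg g by rewrite gS memvf.
  by rewrite -twist_mapE phi0 !zero_lfunE.
- apply/vspaceP => psi; rewrite memv_ker; apply/memv_imgP/eqP => [[phi _ ->]|psi0].
    apply/lfunP => v; rewrite !twist_mapE zero_lfunE.
    have /eqP -> : g (f v) == 0 by rewrite -memv_ker -fg memv_img ?memvf.
    exact: linear0.
  exists ((psi : ldual N) \o g^-1)%VF; rewrite ?memvf //; apply/lfunP => v.
  rewrite twist_mapE comp_lfunE; apply/eqP; rewrite -subr_eq0 -linearB.
  have : v - (g^-1)%VF (g v) \in limg f.
    by rewrite fg memv_ker linearB /= limg_lfunVK ?subrr // memv_img ?memvf.
  case/memv_imgP => u _ ->; have /lfunP/(_ u) := psi0.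
  by rewrite twist_mapE zero_lfunE => pf; apply/eqP; exact: pf.
apply/vspaceP => psi; rewrite memvf; apply/memv_imgP.
exists ((psi : ldual M) \o f^-1)%VF; rewrite ?memvf //; apply/lfunP => v.
by rewrite twist_mapE comp_lfunE lker0_lfunK ?f0.
Qed.

Lemma twist_eta_subproof M :
  bidual M \in @equivariant k A M (twist_dual (twist_dual M)).
Proof.
apply/asboolP => a v; apply/lfunP => phi.
by rewrite twist_actE !bidualE twist_actE invK.
Qed.
Definition twist_eta M : hom M (twist_dual (twist_dual M)) :=
  MkHom (twist_eta_subproof M).

Lemma twist_eta_bij M : bijective (twist_eta M).
Proof. by apply: hom_bij; [apply: bidual_ker | apply: bidual_img]. Qed.

Lemma twist_eta_natural M N (f : hom M N) :
  hom_comp (twist_eta N) f = hom_comp (twist_map (twist_map f)) (twist_eta M).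
Proof.
apply: hom_eqP => v; apply/lfunP => phi.
by rewrite !hom_compE twist_mapE !bidualE twist_mapE.
Qed.

Definition twist_duality : duality A :=
  Duality twist_id twist_comp twist_linear twist_exact twist_eta_bij twist_eta_natural.

End TwistedDual.

(** * Simple modules of a cellular algebra *)

Section Cellular.

Variables (k : fieldType) (A : falgType k) (C : cell_datum A).
Implicit Types S : fdmod A.

Local Notation I := (@cell_index k A C).
Local Notation idx := {g : cell_poset C & (I g * I g)%type}.
Local Notation C_ s t := (@cell_elt k A C _ s t).
Local Notation r := (@cell_coef k A C).
Local Notation ix s t := (@Tagged _ _ (fun g => (I g * I g)%type) (s, t)).

Definition lower_span (g : cell_poset C) : {vspace A} :=
  <<[seq cell_all x | x : idx <- enum predT & (tag x < g)%O]>>%VS.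

(** Basis elements can be separated by linear functionals; this is the form in
    which the linear independence of the cell basis enters. *)
Lemma cell_functional (w : idx -> k) :
  exists f : 'Hom(A, k^o), forall g (s t : I g), f (C_ s t) = w (ix s t).
Proof.
pose X := [seq @cell_all k A C x | x <- enum predT].
have [f fX] := linear_of_free X [seq (w x : k^o) | x <- enum predT].
have {}fX : map f X = [seq (w x : k^o) | x <- enum predT].
  by apply: fX; [apply: basis_free (cell_basis C) | rewrite !size_map].
exists (linfun f) => g s t; rewrite lfunE.
move: fX; rewrite -map_comp => /eq_in_map/(_ (ix s t)); apply.
by rewrite mem_enum.
Qed.

Lemma functional_lower (f : 'Hom(A, k^o)) (g : cell_poset C) (a : A) :
  (forall h (s t : I h), (h < g)%O -> f (C_ s t) = 0) -> a \in lower_span g -> f a = 0.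
Proof.
move=> f0 aL; apply/eqP; rewrite -memv_ker; apply: subvP aL.
apply/span_subvP => b /mapP[[h [s t]]]; rewrite mem_filter => /andP[/= hg _] ->.
by rewrite memv_ker f0.
Qed.

(** The anti-involution permutes the basis elements of each cell. *)
Lemma lower_inv (g : cell_poset C) a :
  a \in lower_span g -> cell_inv C a \in lower_span g.
Proof.
move=> aL; rewrite memv_preim; apply: subvP aL.
apply/span_subvP => _ /mapP[[h [s t]] hg ->].
rewrite -memv_preim cell_invE; apply: memv_span; apply/mapP.
exists (ix t s) => //; rewrite mem_filter mem_enum andbT.
by move: hg; rewrite mem_filter => /andP[].
Qed.

(** The image of the left multiplication rule under the anti-involution. *)
Lemma cell_mulr a g (s t : I g) :
  exists2 l, l \in lower_span g &
    (C_ s t) * a = \sum_u r (cell_inv C a) u t *: (C_ s u) + l.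
Proof.
have [l lL lE] := cell_mul (cell_inv C a) t s.
exists (cell_inv C l); first exact: lower_inv.
rewrite -[LHS](cell_invK C) cell_invM cell_invE lE linearD linear_sum.
by congr (_ + _); apply: eq_bigr => u _; rewrite linearZ /= cell_invE.
Qed.

(** Expand C_(s,t) C_(u,v) modulo lower cells by the left and by the right
    multiplication rule.  The first only involves the C_(x,v), the second only the
    C_(s,y), so only C_(s,v) survives; comparing its coefficients gives the
    identity. *)
Lemma cell_coef_mul g (s t u v x : I g) :
  r (C_ s t) x u = (s == x)%:R * r (C_ v u) v t.
Proof.
have [f fE] := cell_functional (fun y => (y == ix x v)%:R).
have f0 a : a \in lower_span g -> f a = 0.
  apply: functional_lower => h s' t' hg; rewrite fE.
  by case: eqP => // /(congr1 (@tag _ _)) /= E; rewrite E ltxx in hg.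
(* [f] reads off the coefficient of C_(x,v) on both expansions. *)
have [l lL lE] := cell_mul (C_ s t) u v.
have [l' lL' lE'] := cell_mulr (C_ u v) s t.
have := congr1 f lE'; rewrite lE !linearD /= (f0 _ lL) (f0 _ lL') !addr0.
rewrite !linear_sum cell_invE /=.
rewrite (bigD1 x) //= linearZ /= fE eqxx [_ *: _]mulr1 big1 ?addr0; last first.
  move=> y yx; rewrite linearZ /= fE eq_Tagged /= xpair_eqE (negbTE yx).
  exact: mulr0.
move=> ->; rewrite (bigD1 v) //= linearZ /= fE eq_Tagged /= xpair_eqE eqxx andbT.
rewrite big1 ?addr0 => [|y yv]; first exact: mulrC.
by rewrite linearZ /= fE eq_Tagged /= xpair_eqE (negbTE yv) andbF; apply: mulr0.
Qed.

(** [phi] is the Gram matrix of the invariant form of the cell module; its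
    symmetry is [cell_coef_mul] for the product of C_(t,t) and C_(u,u). *)
Lemma cell_gram g : exists phi : I g -> I g -> k,
  (forall t u, phi t u = phi u t) /\
  forall s t u v, (C_ s t) * (C_ u v) - phi t u *: (C_ s v) \in lower_span g.
Proof.
exists (fun t u => r (C_ t t) t u); split=> [t u|s t u v].
  by rewrite (cell_coef_mul t t u u) eqxx mul1r.
have [l lL ->] := cell_mul (C_ s t) u v.
rewrite (bigD1 s) //= big1 => [|x xs]; last first.
  by rewrite (cell_coef_mul s t u u) eq_sym (negbTE xs) mul0r scale0r.
rewrite (cell_coef_mul s t u u) (cell_coef_mul t t u u) !eqxx !mul1r.
by rewrite addr0 addrAC subrr add0r.
Qed.

(** The cell is minimal among those acting nontrivially; one exists because 1
    acts nontrivially. *)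
Lemma cell_support S : (fullv : {vspace S}) <> 0%VS ->
  exists g, (exists s t : I g, act S (C_ s t) <> 0) /\
    forall a, a \in lower_span g -> act S a = 0.
Proof.
move=> S0; pose p (x : idx) := act S (cell_all x) != 0.
have actL : linear (act S) by apply: act_linear.
pose actS : {linear A -> 'End(S)} :=
  HB.pack (act S) (GRing.isLinear.Build k A 'End(S) *:%R (act S) actL).
have act0 (X : seq A) : {in X, forall a, act S a = 0} ->
    forall a, a \in <<X>>%VS -> act S a = 0.
  move=> X0 a aX; apply/eqP; rewrite -[act S a](lfunE actS) -memv_ker.
  apply: subvP aX; apply/span_subvP => b /X0 b0.
  by rewrite memv_ker lfunE; apply/eqP.
have [x0 px0] : exists x, p x.
  apply: contrapT => nop; apply: S0; apply/eqP; rewrite -subv0; apply/subvP => v _.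
  rewrite memv0 -[v]id_lfunE -(act1 S) (act0 [seq @cell_all k A C x | x <- enum predT]).
  - by rewrite zero_lfunE.
  - move=> _ /mapP[x _ ->]; apply/eqP; apply: contraT => px; case: nop; by exists x.
  by rewrite (span_basis (cell_basis C)) memvf.
(* Minimality of a cell is measured by the number of cells below it. *)
case: (arg_minnP (fun x : idx => #|[set h | (h < tag x)%O]|) px0) => -[g [s t]] px minx.
exists g; split; first by exists s, t; apply/eqP.
apply: act0 => b /mapP[y]; rewrite mem_filter => /andP[/= yg _] ->.
apply/eqP; apply: contraT => /minx; rewrite leqNgt => /negP[]; apply: proper_card.
apply/properP; split=> [|]; first by apply/subsetP => h; rewrite !inE => /lt_trans; apply.
by exists (tag y); rewrite !inE ?ltxx.
Qed.

(** Fix C_(s0,t0) and [x] with C_(s0,t0) x nonzero.  The vectors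
    y_u = C_(u,t0) x transform under [A] like the basis of the cell module and
    span [S].  Composing the action of C_(s0,t) with a functional [lam] that is 1
    on y_(s0) gives functionals psi_t that transform in the same way in the dual,
    and psi_t(y_u) is the Gram matrix.  Symmetry of that matrix shows that every
    linear relation among the y_u holds among the psi_u, so y_u |-> psi_u is a
    nonzero homomorphism from [S] to its dual, and dimensions agree. *)
Lemma cell_simple_self_dual S : simple S ->
  iso S (twist_dual (@cell_invM k A C) (@cell_invK k A C) S).
Proof.
move=> sS; have [g [[s0 [t0 st0]] low0]] := cell_support sS.1.
have [phi [phiC phiE]] := cell_gram g.
have actB a b : act S (a - b) = act S a - act S b.
  by rewrite -[a - b]addrC -scaleN1r act_linear scaleN1r addrC.
have actZ c a : act S (c *: a) = c *: act S a.
  have a0 : act S 0 = 0 by apply: low0; apply: mem0v.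
  by rewrite -[c *: a]addr0 act_linear a0 addr0.
have actD a b : act S (a + b) = act S a + act S b.
  by rewrite -[a]scale1r act_linear !scale1r.
have act_sum (c : I g -> k) (E : I g -> A) :
    act S (\sum_u c u *: E u) = \sum_u c u *: act S (E u).
  have a0 : act S 0 = 0 by apply: low0; apply: mem0v.
  by rewrite (big_morph (act S) actD a0); apply: eq_bigr => u _; rewrite actZ.
have [x stx] : exists x, act S (C_ s0 t0) x != 0.
  apply: contrapT => nox; apply: st0; apply/lfunP => x; rewrite zero_lfunE.
  by apply/eqP; apply: contraT => stx; case: nox; exists x.
pose y u : S := act S (C_ u t0) x.
have yE a u : act S a (y u) = \sum_v r a v u *: y v.
  have [l lL lE] := cell_mul a u t0.
  rewrite /y -[LHS]comp_lfunE -actM lE actD (low0 _ lL) addr0 act_sum sum_lfunE.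
  by apply: eq_bigr => v _; rewrite scale_lfunE.
have yphi s t u : act S (C_ s t) (y u) = phi t u *: y s.
  rewrite /y -[LHS]comp_lfunE -actM; apply/eqP; rewrite -subr_eq0 -scale_lfunE.
  by rewrite -actZ -opp_lfunE -add_lfunE -actB (low0 _ (phiE _ _ _ _)) zero_lfunE.
pose Y := [seq y u | u <- enum (I g)].
have memY u : y u \in Y by rewrite map_f ?mem_enum.
have Yst : <<Y>>%VS \in @stable k A S.
  apply/asboolP => a v vY; rewrite memv_preim; apply: subvP vY.
  apply/span_subvP => _ /mapP[u _ ->]; rewrite -memv_preim yE.
  by apply: rpred_sum => w _; rewrite rpredZ // memv_span.
have Yfull : <<Y>>%VS = fullv.
  case: sS => _ /(_ (Submod Yst)) /= [Y0|//]; case/eqP: stx; apply/eqP.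
  by rewrite -memv0 -Y0; apply/memv_span/(memY s0).
have [lam lamE] := functional_sep stx.
pose psi t : ldual S := (lam \o act S (C_ s0 t))%VF.
have psiE t u : psi t (y u) = phi t u.
  by rewrite comp_lfunE yphi linearZ /= lamE; apply: mulr1.
have psi_act a t : (psi t \o act S (cell_inv C a))%VF = \sum_v r a v t *: psi v.
  apply/lfunP => v; rewrite /psi !comp_lfunE -[act S (C_ s0 t) _]comp_lfunE -actM.
  have [l lL ->] := cell_mulr (cell_inv C a) s0 t.
  rewrite cell_invK actD (low0 _ lL) addr0 act_sum !sum_lfunE linear_sum.
  by apply: eq_bigr => u _; rewrite !scale_lfunE linearZ comp_lfunE.
(* This is where the symmetry of [phi] enters: the value of a combination of the
   psi_v at y_u is the value of psi_u at the same combination of the y_v. *)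
have [f fE] : exists f : 'Hom(S, ldual S), forall u, f (y u) = psi u.
  apply: lfun_of_relations => c c0; apply/(fullv_lfunP _ _ Yfull) => _ /mapP[u _ ->].
  rewrite zero_lfunE sum_lfunE.
  transitivity (psi u (\sum_v c v *: y v)); last by rewrite c0 linear0.
  rewrite linear_sum; apply: eq_bigr => v _.
  by rewrite scale_lfunE linearZ /= !psiE phiC.
have f_equiv : f \in @equivariant k A S
    (twist_dual (@cell_invM k A C) (@cell_invK k A C) S).
  apply/asboolP => a v; set T := twist_dual _ _ _.
  suff : (f \o act S a = act T a \o f)%VF by move/lfunP/(_ v); rewrite !comp_lfunE.
  apply/(fullv_lfunP _ _ Yfull) => _ /mapP[u _ ->].
  rewrite !comp_lfunE yE linear_sum fE; apply/lfunP => w.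
  rewrite [RHS]twist_actE -comp_lfunE psi_act; congr (fun_of_lfun _ w).
  by apply: eq_bigr => t _; rewrite linearZ /= fE.
pose F := MkHom f_equiv.
(* Otherwise psi_(t0), hence row t0 of the Gram matrix, vanishes, and C_(s0,t0)
   kills all the y_u. *)
have F0 : F <> 0.
  move=> F0; apply: st0; apply/(fullv_lfunP _ _ Yfull) => _ /mapP[u _ ->].
  rewrite yphi -psiE -fE; have -> : f (y t0) = 0 by rewrite -[f]/(F : 'Hom(_, _)) F0 zero_lfunE.
  by rewrite !zero_lfunE scale0r.
have kF := simple_ker sS F0; exists F; apply: hom_bij => //.
apply/eqP; rewrite eqEdim subvf limg_dim_eq ?kF ?capv0 //.
by rewrite dim_ldual leqnn.
Qed.

End Cellular.

(** * Symmetry of the radical layers *)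

Theorem theorem6 (k : closedFieldType) (A : falgType k) (pi : Type)
    (L P : pi -> fdmod A)
    (hL : full_set_of_simples L)
    (hP : forall lambda : pi, projective_cover (P lambda) (L lambda))
    (hA : cellular A \/ BGG_algebra L P)
    (lambda mu : pi) (s : nat) (hs : (1 <= s)%N) :
  mult (rad_layer s (P mu)) (L lambda) = mult (rad_layer s (P lambda)) (L mu).
Proof.
case: s hs => // s _; case: hA => [[C]|[le [_ _ [d dL]]]]; last first.
  exact: rad_layer_sym hL hP _ dL _ _ _.
pose d := twist_duality (@cell_invM k A C) (@cell_invK k A C).
apply: (rad_layer_sym hL hP (d := d)) => l.
by apply/iso_sym/cell_simple_self_dual; case: hL.
Qed.
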